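(* All spaces below are MMD spaces, $\sigma,\sigma_i,\sigma'\in\mathbb R$, $N,N_i>0$, $q\in[0,N]$. (i) Monotonicity. If $X\in\mathrm{HSCod}(\sigma,N,q)$, then $X\in\mathrm{HSCod}(\sigma',N,q')$ for every $\sigma'\le\sigma$ and $0\le q'\le q$, with the same witness scales whenever the corresponding clause is nonvacuous. (ii) Scaling and measure renormalization. For $a,c>0$, equip $X$ with $\mathsf d_a=a\mathsf d$, $\mathfrak m_a=c\mathfrak m$ and $\mathcal E_{a,c}=ca^{-2}\mathcal E$. Then $$X\in\mathrm{HSCod}(\sigma,N,q)\ \Longrightarrow\ (X,a\mathsf d,c\mathfrak m)\in\mathrm{HSCod}(a^{-2}\sigma,N,q).$$ Likewise, if $X$ has heat scalar curvature at least $\sigma$ in dimension $N$, then $(X,a\mathsf d,c\mathfrak m)$ has heat scalar curvature at least $a^{-2}\sigma$ in dimension $N$. (iii) Products. If $X_i$ has heat scalar curvature at least $\sigma_i$ in dimension $N_i$, $i=1,2$, then $X_1\times X_2$ has heat scalar curvature at least $\sigma_1+\sigma_2$ in dimension $N_1+N_2$. If moreover $q_1,q_2>0$ ($q_i\le N_i$) and $X_i\in\mathrm{HSCod}(\sigma_i,N_i,q_i)$ for $i=1,2$, then $$X_1\times X_2\in\mathrm{HSCod}(\sigma_1+\sigma_2,N_1+N_2,q_1+q_2).$$ If $X\in\mathrm{HSCod}(\sigma,N,q)$, then for every integer $m\ge1$, $$X\times\mathbb R^m\in\mathrm{HSCod}(\sigma,N+m,q),$$ with the Euclidean factor normalized by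 its dimension $m$.
   Context: MMD space (metric measure Dirichlet space): a proper complete separable metric space $(X,\mathsf d)$, a full-support Radon measure $\mathfrak m$, and a strongly local regular symmetric Dirichlet form $(\mathcal E,\mathcal D(\mathcal E))$ on $L^2(X,\mathfrak m)$ whose energy measures are absolutely continuous with respect to $\mathfrak m$, with carré du champ density $\Gamma$, and such that the intrinsic distance $\sup\{f(x)-f(y): f\in\mathcal D_{\rm loc}(\mathcal E)\cap C(X),\ \Gamma(f)\le1\ \mathfrak m\text{-a.e.}\}$ equals $\mathsf d(x,y)$. Standing assumptions on every MMD space: the heat semigroup $(P_t)_{t>0}$ is conservative and has a jointly continuous, strictly positive, symmetric heat kernel $p:(0,\infty)\times X\times X\to(0,\infty)$ with $P_tf(x)=\int_Xp_t(x,y)f(y)\,d\mathfrak m(y)$ for bounded Borel $f$, $\int_Xp_t(x,y)\,d\mathfrak m(y)=1$, and $p_{t+s}(x,y)=\int_Xp_t(x,z)p_s(z,y)\,d\mathfrak m(z)$; for the normalization dimensions $N>0$ in use, the pointed Nash entropies $$\mathcal N_x^{(N)}(t):=-\int_Xp_t(x,y)\log p_t(x,y)\,d\mathfrak m(y)-\frac N2\log(4\pi t)-\frac N2$$ are finite for all $x\in X$, $t>0$, and $\mathcal N^{(N)}_\bullet(t)$ is integrable against $p_s(x,\cdot)\mathfrak m$ for all $x$ and $s,t>0$. Put $\mathbf N_x^{(N)}(t,s):=P_s(\mathcal N^{(N)}_\bullet(t))(x)$. Products carry the $\ell^2$ product distance, the product measure and the product Dirichlet form, so the heat kernel of the product is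 the product of the heat kernels. $\mathbb R^m$ carries the Euclidean distance, Lebesgue measure and the form $\int|\nabla f|^2$. Inverse-time geodesics: curves $\gamma_\theta=(t_\theta,s_\theta)\in(0,\infty)^2$, $\theta\in[0,1]$, with $t_\theta+s_\theta$ constant and $t_\theta^{-1}=(1-\theta)t_0^{-1}+\theta t_1^{-1}$. A function is concave along $\gamma$ if its composition with $\theta\mapsto\gamma_\theta$ is concave on $[0,1]$. Put $\mathscr T_S^+:=\{(t,s):S\le t\le s\}$. $X$ has heat scalar curvature at least $\sigma$ in dimension $N$ if there is $\tau>0$ (a witness scale, independent of $x$) such that for every $x\in X$, $\mathbf N_x^{(N)}(t,s)+\frac\sigma2t$ is concave along every inverse-time geodesic contained in $(0,\tau)^2$. $X\in\mathrm{HSCod}(\sigma,N,q)$, $q\in[0,N]$, if in addition, when $q>0$, there is $S>0$ (a witness scale, independent of $x$) such that for every $x\in X$, $\mathbf N_x^{(N)}(t,s)+\frac q2\log t$ is concave along every inverse-time geodesic contained in $\mathscr T_S^+$; for $q=0$ there is no second clause. *)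

(* Defs.v *)
From HB Require Import structures.
From mathcomp Require Import all_boot all_order all_algebra.
From mathcomp Require Import all_classical all_reals all_analysis.

Set Implicit Arguments.
Unset Strict Implicit.
Unset Printing Implicit Defensive.
Import Order.TTheory GRing.Theory Num.Theory.
Import numFieldNormedType.Exports.

Local Open Scope classical_set_scope.
Local Open Scope ring_scope.

(* No compatibility between the two structures is built in here: that the
   sigma-algebra is the Borel one is part of [metric_measure] below. *)
#[short(type="topMeasurableType")]
HB.structure Definition TopMeasurable (d : measure_display) :=
  {T of Measurable d T & Topological T}.

HB.instance Definition _ d1 d2 (T1 : topMeasurableType d1)
    (T2 : topMeasurableType d2) := Topological.on (T1 * T2)%type.

Section rV_borel.
Variables (R : realType) (m : nat).

HB.instance Definition _ :=
  @isMeasurable.Build (sigma_display (@open 'rV[R]_m)) 'rV[R]_m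
    <<s @open 'rV[R]_m >> (@sigma_algebra0 _ setT (@open 'rV[R]_m))
    (@sigma_algebraC _ (@open 'rV[R]_m))
    (@sigma_algebra_bigcup _ setT (@open 'rV[R]_m)).

End rV_borel.


(* Elements of L^2 are represented by measurable functions; [mmd_dom] is a set
   of representatives, closed under a.e. equality by [dirichlet_form], and
   [mmd_form], [mmd_cdc] are only meaningful on it.  The sigma-finiteness bundled in
   [mmd_meas] is automatic for a Radon measure on a proper space. *)
Record mmd_data (R : realType) d (T : topMeasurableType d) := MMDData {
  mmd_dist : T -> T -> R ;
  mmd_meas : {sigma_finite_measure set T -> \bar R} ;
  mmd_dom : set (T -> R) ;
  mmd_form : (T -> R) -> (T -> R) -> R ;
  mmd_cdc : (T -> R) -> T -> R ;
  mmd_kernel : R -> T -> T -> R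
}.

Section mmd_axioms.
Variables (R : realType) (d : measure_display) (T : topMeasurableType d).
Variable X : mmd_data R T.

Local Notation dist := (mmd_dist X).
Local Notation m := (mmd_meas X).
Local Notation D := (mmd_dom X).
Local Notation E := (mmd_form X).
Local Notation Gam := (mmd_cdc X).
Local Notation p := (mmd_kernel X).
Local Notation L2 := [set f : T -> R | f \in Lfun m 2%:E].

Definition Cc : set (T -> R) :=
  [set f | continuous f /\ compact (closure [set x | f x != 0])].

Definition metrizes : Prop :=
  [/\ forall x y, dist x y = 0 <-> x = y,
      forall x y, dist x y = dist y x,
      forall x y z, dist x z <= dist x y + dist y z &
      forall x : T, nbhs x =
        filter_from [set e : R | 0 < e] (fun e => [set y | dist x y < e])].

Definition proper_space : Prop :=
  forall (x : T) (r : R), compact [set y | dist x y <= r].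

Definition complete_space : Prop :=
  forall u : nat -> T,
    (forall e : R, 0 < e -> exists n0 : nat, forall i j : nat,
       (n0 <= i)%N -> (n0 <= j)%N -> dist (u i) (u j) < e) ->
    exists x : T, u @ \oo --> x.

Definition separable_space : Prop := exists2 S : set T, countable S & dense S.

Definition radon : Prop :=
  (forall K : set T, compact K -> (m K < +oo)%E) /\
  (forall A : set T, measurable A ->
     m A = ereal_sup [set m K | K in [set K | compact K /\ K `<=` A]]).

Definition full_support : Prop :=
  forall U : set T, open U -> U !=set0 -> (0 < m U)%E.

Record metric_measure : Prop := {
  mm_metric : metrizes ;
  mm_proper : proper_space ;
  mm_complete : complete_space ;
  mm_separable : separable_space ;
  mm_borel : @measurable d T = <<s @open T >> ;
  mm_radon : radon ;
  mm_full_support : full_support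
}.

Definition sqnorm (f : T -> R) : R := \int[m]_x (f x ^+ 2).

Definition energy1 (f : T -> R) : R := E f f + sqnorm f.

Record dirichlet_form : Prop := {
  df_L2 : D `<=` L2 ;
  df_ae : forall f g, D f -> measurable_fun setT g -> f = g %[ae m] ->
    D g /\ forall h, D h -> E g h = E f h ;
  df_zero : D (cst 0) ;
  df_lin : forall (a : R) f g, D f -> D g -> D (cst a \* f \+ g) ;
  df_dense : forall f, L2 f -> forall e : R, 0 < e ->
    exists2 g, D g & sqnorm (f \- g) < e ;
  df_bilin : forall (a : R) f g h, D f -> D g -> D h ->
    E (cst a \* f \+ g) h = a * E f h + E g h ;
  df_sym : forall f g, D f -> D g -> E f g = E g f ;
  df_ge0 : forall f, D f -> 0 <= E f f ;
  df_closed : forall u : nat -> T -> R, (forall n, D (u n)) ->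
    (forall e : R, 0 < e -> exists n0 : nat, forall i j : nat,
       (n0 <= i)%N -> (n0 <= j)%N -> energy1 (u i \- u j) < e) ->
    exists2 f, D f & energy1 (u n \- f) @[n --> \oo] --> 0 ;
  df_markov : forall f, D f ->
    let f01 x := Num.max 0 (Num.min (f x) 1) in
    D f01 /\ E f01 f01 <= E f f
}.

Definition regular_form : Prop :=
  (forall f, D f -> forall e : R, 0 < e ->
     exists g, [/\ D g, Cc g & energy1 (f \- g) < e]) /\
  (forall f, Cc f -> forall e : R, 0 < e ->
     exists g, [/\ D g, Cc g & forall x, `|f x - g x| < e]).

(* The support of the measure f m. *)
Definition msupport (f : T -> R) : set T :=
  [set x | forall U, open_nbhs x U -> ~ f = cst 0 %[ae m in U]].

Definition strongly_local : Prop :=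
  forall f g, D f -> D g -> compact (msupport f) -> compact (msupport g) ->
    (exists U (c : R),
       [/\ open U, msupport f `<=` U & g = cst c %[ae m in U]]) ->
    E f g = 0.

Definition trunc (n : nat) (f : T -> R) : T -> R :=
  fun x => Num.max (- n%:R) (Num.min (f x) n%:R).

(* The energy measure mu_f of f in D is determined by
     int phi dmu_f = E(phi f, f) - E(f^2, phi)/2    (phi in D cap C_c)
   for bounded f, and by monotone approximation by truncations in general; it is
   normalized so that E(f, f) is its total mass, as for int |grad f|^2.  The
   condition says that mu_f = g m. *)
Definition energy_density (f g : T -> R) : Prop :=
  [/\ forall x, 0 <= g x, m.-integrable setT (EFin \o g) &
      forall phi, D phi -> Cc phi ->
        (E (phi \* trunc n f) (trunc n f)
           - E (trunc n f \* trunc n f) phi / 2) @[n --> \oo]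
        --> \int[m]_x (phi x * g x)].

Definition carre_du_champ : Prop := forall f, D f -> energy_density f (Gam f).

Definition rel_compact_open (U : set T) : Prop := open U /\ compact (closure U).

Definition dom_loc : set (T -> R) :=
  [set f | forall U, rel_compact_open U ->
     exists2 g, D g & f = g %[ae m in U]].

(* [G] is the carre du champ of f in D_loc, defined locally; this makes sense
   by locality of the energy measures. *)
Definition cdc_loc (f G : T -> R) : Prop :=
  forall U g, rel_compact_open U -> D g -> f = g %[ae m in U] ->
    G = Gam g %[ae m in U].

Definition intrinsic_dist (x y : T) : \bar R :=
  ereal_sup [set (f x - f y)%:E | f in
    [set f | [/\ dom_loc f, continuous f &
      exists2 G, cdc_loc f G & \forall z \ae m, G z <= 1]]].

(* The generator: f in D(L) and L f = h. *)
Definition generator (f h : T -> R) : Prop :=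
  [/\ D f, L2 h & forall g, D g -> E f g = - (\int[m]_x (h x * g x))].

(* P_t f solves (d/dt) P_t f = L P_t f in L^2 for t > 0, with P_t f -> f in L^2
   as t -> 0; this determines P_t f in L^2. *)
Definition heat_semigroup (P : R -> (T -> R) -> T -> R) : Prop :=
  forall f, L2 f ->
    (forall t : R, 0 < t -> exists2 h, generator (P t f) h &
       sqnorm (fun x => (P (t + s) f x - P t f x) / s - h x) @[s --> 0^']
       --> 0) /\
    sqnorm (P t f \- f) @[t --> 0^'+] --> 0.

Definition heat (t : R) (f : T -> R) : T -> R :=
  fun x => \int[m]_y (p t x y * f y).

Record heat_kernel : Prop := {
  hk_semigroup : heat_semigroup heat ;
  hk_gt0 : forall (t : R) x y, 0 < t -> 0 < p t x y ;
  hk_continuous : forall (t : R) x y, 0 < t ->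
    {for (t, x, y), continuous (fun z : R * T * T => p z.1.1 z.1.2 z.2)} ;
  hk_sym : forall (t : R) x y, 0 < t -> p t x y = p t y x ;
  hk_conservative : forall (t : R) x, 0 < t -> (\int[m]_y p t x y) = 1 ;
  hk_chapman_kolmogorov : forall (t s : R) x y, 0 < t -> 0 < s ->
    p (t + s) x y = \int[m]_z (p t x z * p s z y)
}.

Definition nash (N : R) (x : T) (t : R) : R :=
  - (\int[m]_y (p t x y * ln (p t x y))) - N / 2 * ln (4 * pi * t) - N / 2.

Definition nash2 (N : R) (x : T) (t s : R) : R :=
  heat s (fun y => nash N y t) x.

Record nash_regular : Prop := {
  nash_finite : forall x (t : R), 0 < t ->
    m.-integrable setT (fun y => (p t x y * ln (p t x y))%:E) ;
  nash_integrable : forall (N : R) x (s t : R), 0 < N -> 0 < s -> 0 < t ->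
    m.-integrable setT (fun y => (p s x y * nash N y t)%:E)
}.

End mmd_axioms.

Record MMD (R : realType) d (T : topMeasurableType d) := {
  mmd_struct :> mmd_data R T ;
  mmd_metric_measure : metric_measure mmd_struct ;
  mmd_dirichlet : dirichlet_form mmd_struct ;
  mmd_regular : regular_form mmd_struct ;
  mmd_local : strongly_local mmd_struct ;
  mmd_energy_density : carre_du_champ mmd_struct ;
  mmd_intrinsic : forall x y,
    (mmd_dist mmd_struct x y)%:E = intrinsic_dist mmd_struct x y ;
  mmd_heat : heat_kernel mmd_struct ;
  mmd_nash : nash_regular mmd_struct
}.

Section heat_curvature.
Variable R : realType.

Definition inverse_time_geodesic (c : R -> R * R) : Prop :=
  forall th : R, 0 <= th <= 1 ->
    [/\ 0 < (c th).1, 0 < (c th).2,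
        (c th).1 + (c th).2 = (c 0).1 + (c 0).2 &
        (c th).1^-1 = (1 - th) * (c 0).1^-1 + th * (c 1).1^-1].

Definition concave_along (F : R -> R -> R) (c : R -> R * R) : Prop :=
  convex_function (`[0, 1]%classic : set R^o)
    (fun th : R^o => - F (c th).1 (c th).2).

Variables (d : measure_display) (T : topMeasurableType d) (X : MMD R T).

Definition hsc_witness (sigma N tau : R) : Prop :=
  0 < tau /\
  forall x c, inverse_time_geodesic c ->
    (forall th : R, 0 <= th <= 1 -> (c th).1 < tau /\ (c th).2 < tau) ->
    concave_along (fun t s => nash2 X N x t s + sigma / 2 * t) c.

Definition od_witness (N q S : R) : Prop :=
  0 < S /\
  forall x c, inverse_time_geodesic c ->
    (forall th : R, 0 <= th <= 1 -> S <= (c th).1 /\ (c th).1 <= (c th).2) ->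
    concave_along (fun t s => nash2 X N x t s + q / 2 * ln t) c.

(* heat scalar curvature at least sigma in dimension N *)
Definition HSC (sigma N : R) : Prop := exists tau : R, hsc_witness sigma N tau.

Definition HSCod (sigma N q : R) : Prop :=
  HSC sigma N /\ (0 < q -> exists S : R, od_witness N q S).

End heat_curvature.

(* Y is (X, a dist, c m) with the form c a^-2 E. *)
Definition is_rescaling (R : realType) d (T : topMeasurableType d) (a c : R)
    (X Y : MMD R T) : Prop :=
  [/\ forall x y, mmd_dist Y x y = a * mmd_dist X x y,
      forall A, measurable A -> mmd_meas Y A = (c%:E * mmd_meas X A)%E,
      mmd_dom Y = mmd_dom X &
      forall f g, mmd_dom X f -> mmd_dom X g ->
        mmd_form Y f g = c * a ^- 2 * mmd_form X f g].

(* The quadratic form of X, extended by +oo outside of its domain. *)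
Definition energy (R : realType) d (T : topMeasurableType d) (X : MMD R T)
    (f : T -> R) : \bar R :=
  if `[< mmd_dom X f >] then (mmd_form X f f)%:E else +oo%E.

Definition product_energy (R : realType) d1 d2 (T1 : topMeasurableType d1)
    (T2 : topMeasurableType d2) (X1 : MMD R T1) (X2 : MMD R T2)
    (f : T1 * T2 -> R) : \bar R :=
  ((\int[mmd_meas X2]_y energy X1 (fun x => f (x, y))) +
   (\int[mmd_meas X1]_x energy X2 (fun y => f (x, y))))%E.

Definition is_product (R : realType) d1 d2 (T1 : topMeasurableType d1)
    (T2 : topMeasurableType d2) (X1 : MMD R T1) (X2 : MMD R T2)
    (Y : MMD R (T1 * T2)%type) : Prop :=
  [/\ forall z w, mmd_dist Y z w =
        Num.sqrt (mmd_dist X1 z.1 w.1 ^+ 2 + mmd_dist X2 z.2 w.2 ^+ 2),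
      forall A, measurable A ->
        mmd_meas Y A = (mmd_meas X1 \x mmd_meas X2)%E A,
      forall f, mmd_dom Y f <->
        f \in Lfun (mmd_meas Y) 2%:E /\ (product_energy X1 X2 f < +oo)%E &
      forall f, mmd_dom Y f -> (mmd_form Y f f)%:E = product_energy X1 X2 f].

Section euclidean.
Variables (R : realType) (m : nat).

Local Notation e_ i := (delta_mx 0 i : 'rV[R]_m).

Definition C1c (phi : 'rV[R]_m -> R) : Prop :=
  Cc phi /\ forall i, (forall x, derivable phi x (e_ i)) /\
                      continuous (fun x => 'D_(e_ i) phi x).

Definition weak_gradient (mu : {measure set 'rV[R]_m -> \bar R})
    (f : 'rV[R]_m -> R) (g : 'I_m -> 'rV[R]_m -> R) : Prop :=
  forall i, g i \in Lfun mu 2%:E /\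
    forall phi, C1c phi ->
      \int[mu]_x (f x * 'D_(e_ i) phi x) = - (\int[mu]_x (g i x * phi x)).

(* R^m with Lebesgue measure, characterized by its values on boxes, and the
   form int |grad f|^2 on W^{1,2}. *)
Definition is_euclidean (X : MMD R 'rV[R]_m) : Prop :=
  [/\ forall x y, mmd_dist X x y =
        Num.sqrt (\sum_(i < m) (x 0 i - y 0 i) ^+ 2),
      forall a b : 'rV[R]_m, (forall i, a 0 i <= b 0 i) ->
        mmd_meas X [set x | forall i, a 0 i < x 0 i <= b 0 i] =
        (\prod_(i < m) (b 0 i - a 0 i))%:E,
      forall f, mmd_dom X f <->
        f \in Lfun (mmd_meas X) 2%:E /\
        exists g, weak_gradient (mmd_meas X) f g &
      forall f1 f2 g1 g2, mmd_dom X f1 -> mmd_dom X f2 ->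
        weak_gradient (mmd_meas X) f1 g1 ->
        weak_gradient (mmd_meas X) f2 g2 ->
        mmd_form X f1 f2 =
        \sum_(i < m) \int[mmd_meas X]_x (g1 i x * g2 i x)].

End euclidean.

(* Main.v *)
(** The L^2 heat flow is unique, since the difference [w] of two solutions satisfies
    [d/dt |w|^2 = - 2 E(w, w) <= 0]; by continuity and full support, a kernel is
    therefore determined by its action on indicators of small open sets.  Exhibiting
    solutions identifies the heat kernels: an isomorphism that multiplies the measure
    by [k] and the form by [k l] multiplies the kernel by [1/k] and time by [l], and
    the tensor product of two solutions is a solution on the product, so that product
    kernels are products.  Hence iterated Nash entropies change by a constant and a
    time scaling under rescaling, and add up on products.  Applied to dilations and
    translations of [R^m], the first fact shows that its Nash entropy is constant.
    Finally, along an inverse-time geodesic [1/t] is affine, so [t] and [log t] are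
    convex. *)
Require Import Defs.
From HB Require Import structures.
From mathcomp Require Import all_boot all_order all_algebra.
From mathcomp Require Import all_classical all_reals all_analysis.
From mathcomp Require Import measurable_realfun ring lra.

Set Implicit Arguments.
Unset Strict Implicit.
Unset Printing Implicit Defensive.
Import Order.TTheory GRing.Theory Num.Theory.
Import numFieldNormedType.Exports.

Local Open Scope classical_set_scope.
Local Open Scope ring_scope.

(** The delicate point is the product. Its form is known only as a quadratic form, the sum of the
    integrated energies of sections, and these energies need not be measurable, so their integrals
    are lower integrals and bilinear information has to be recovered from them. This works for a
    tensor of [a] and [b] in the domains of the two generators: adding it to [g] changes the energy
    of every section by an explicit integrable amount, and the cross term is exactly the weak form
    of the product generator, which is what the heat equation asks for. Indicators of open sets
    serve as initial data because small balls have finite measure by properness, and because the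
    indicator of a rectangle is a tensor. The null set off which two flows agree depends on the
    chosen set, but a single set is enough to refute a strict inequality between continuous kernels.
    Real integrals are 0 by convention when the extended integral is infinite, so integrability has
    to be carried along. *)

Section real_integrable.
Context d (T : measurableType d) (R : realType) (m : {measure set T -> \bar R}).
Implicit Types f g : T -> R.

Lemma integrable_measurable f : m.-integrable setT (EFin \o f) ->
  measurable_fun setT f.
Proof. by move/measurable_int/measurable_EFinP. Qed.

Lemma integrable_EFinZl c f : m.-integrable setT (EFin \o f) ->
  m.-integrable setT (EFin \o (fun x => c * f x)).
Proof. by move=> fi; exact: (integrableZl measurableT c fi). Qed.

Lemma integrable_EFinD f g : m.-integrable setT (EFin \o f) ->
  m.-integrable setT (EFin \o g) ->
  m.-integrable setT (EFin \o (fun x => f x + g x)).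
Proof. by move=> fi gi; exact: (integrableD measurableT fi gi). Qed.

Lemma integrable_EFinB f g : m.-integrable setT (EFin \o f) ->
  m.-integrable setT (EFin \o g) ->
  m.-integrable setT (EFin \o (fun x => f x - g x)).
Proof. by move=> fi gi; exact: (integrableB measurableT fi gi). Qed.

End real_integrable.

(** * The L^2 inner product on representatives *)

Section square_integrable.
Context d (T : measurableType d) (R : realType) (m : {measure set T -> \bar R}).
Implicit Types f g h : T -> R.

Definition inner f g : R := \int[m]_x (f x * g x).

Lemma Lfun2P f : f \in Lfun m 2%:E <->
  measurable_fun setT f /\ m.-integrable setT (EFin \o (fun x => f x ^+ 2)).
Proof.
split=> [fL|[mf /integrableP[_ fi]]].
  split; last exact: Lfun2_integrable_sqr.
  by move: fL; rewrite inE => /andP[/[!inE]].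
rewrite inE; apply/andP; split; rewrite inE//= /finite_norm unlock/= poweR_lty//.
apply: le_lt_trans fi; rewrite le_eqVlt; apply/orP; left; apply/eqP.
by apply: eq_integral => x _ /=; rewrite powR_mulrn// -normrX.
Qed.

Lemma Lfun2_measurable f : f \in Lfun m 2%:E -> measurable_fun setT f.
Proof. by case/Lfun2P. Qed.

Lemma Lfun2_integrableM f g : f \in Lfun m 2%:E -> g \in Lfun m 2%:E ->
  m.-integrable setT (EFin \o (fun x => f x * g x)).
Proof. by move=> fL gL; apply/Lfun1_integrable/Lfun2_mul_Lfun1. Qed.

Lemma Lfun2_lin a f g : f \in Lfun m 2%:E -> g \in Lfun m 2%:E ->
  (fun x => a * f x + g x) \in Lfun m 2%:E.
Proof.
move=> fL gL; have ff := Lfun2_integrableM fL fL.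
have fg := Lfun2_integrableM fL gL; have gg := Lfun2_integrableM gL gL.
apply/Lfun2P; split.
  apply: measurable_funD; last exact: Lfun2_measurable.
  by apply: measurable_funM => //; exact: Lfun2_measurable.
have := integrableD measurableT (integrableD measurableT
  (integrableZl measurableT (a ^+ 2) ff) (integrableZl measurableT (2 * a) fg)) gg.
apply: (eq_integrable measurableT) => // x _ /=; rewrite -!EFinM -!EFinD; congr EFin; ring.
Qed.

Lemma Lfun2_cst0 : cst 0 \in Lfun m 2%:E.
Proof.
apply/Lfun2P; split => //.
apply: (eq_integrable measurableT (cst 0%E)); last exact: integrable0.
by move=> x _ /=; rewrite expr0n.
Qed.

Lemma Lfun2Z a f : f \in Lfun m 2%:E -> (fun x => a * f x) \in Lfun m 2%:E.
Proof.
move=> fL; rewrite (_ : (fun x => _) = fun x => a * f x + cst 0 x).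
  exact: Lfun2_lin Lfun2_cst0.
by apply/funext => x /=; rewrite addr0.
Qed.

Lemma Lfun2B f g : f \in Lfun m 2%:E -> g \in Lfun m 2%:E ->
  f \- g \in Lfun m 2%:E.
Proof.
move=> fL gL; rewrite (_ : f \- g = fun x => -1 * g x + f x).
  exact: Lfun2_lin.
by apply/funext => x /=; ring.
Qed.

Lemma innerC f g : inner f g = inner g f.
Proof. by rewrite /inner; under eq_Rintegral do rewrite mulrC. Qed.

Lemma inner_lin a f g h : f \in Lfun m 2%:E -> g \in Lfun m 2%:E ->
  h \in Lfun m 2%:E ->
  inner (fun x => a * f x + g x) h = a * inner f h + inner g h.
Proof.
move=> fL gL hL.
have fh := Lfun2_integrableM fL hL; have gh := Lfun2_integrableM gL hL.
rewrite /inner -RintegralZl// -RintegralD//; last exact: (integrableZl _ a fh).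
by apply: eq_Rintegral => x _; ring.
Qed.

Lemma inner0l h : inner (cst 0) h = 0.
Proof.
rewrite /inner (_ : (fun x => _) = cst 0); first by rewrite Rintegral_cst// mul0r.
by apply/funext => x /=; rewrite mul0r.
Qed.

Lemma innerZl a f h : f \in Lfun m 2%:E -> h \in Lfun m 2%:E ->
  inner (fun x => a * f x) h = a * inner f h.
Proof.
move=> fL hL; have := inner_lin a fL Lfun2_cst0 hL.
rewrite inner0l addr0 => <-; congr (inner _ _).
by apply/funext => x /=; rewrite addr0.
Qed.

Lemma innerBl f g h : f \in Lfun m 2%:E -> g \in Lfun m 2%:E ->
  h \in Lfun m 2%:E -> inner (f \- g) h = inner f h - inner g h.
Proof.
move=> fL gL hL; have := inner_lin (-1) gL fL hL.
rewrite mulN1r addrC => <-; congr (inner _ _).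
by apply/funext => x /=; ring.
Qed.

Lemma inner_ge0 f : 0 <= inner f f.
Proof. by apply: Rintegral_ge0 => x _; rewrite -expr2 sqr_ge0. Qed.

Lemma inner_sqr_lin a f g : f \in Lfun m 2%:E -> g \in Lfun m 2%:E ->
  inner (fun x => a * f x + g x) (fun x => a * f x + g x) =
  a ^+ 2 * inner f f + 2 * a * inner f g + inner g g.
Proof.
move=> fL gL; have hL := Lfun2_lin a fL gL.
have innerr h : h \in Lfun m 2%:E ->
    inner h (fun x => a * f x + g x) = a * inner f h + inner g h.
  by move=> hL2; rewrite innerC inner_lin.
by rewrite inner_lin// !innerr// (innerC g f); ring.
Qed.

(** Nonnegativity of [|a f + g|^2] for a suitable [a]. If [inner f f] vanishes, this quadratic is
    affine in [a], and would become negative unless [inner f g] vanishes too. *)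
Lemma cauchy_schwarz f g : f \in Lfun m 2%:E -> g \in Lfun m 2%:E ->
  inner f g ^+ 2 <= inner f f * inner g g.
Proof.
move=> fL gL; have [ff0|ff_neq0] := eqVneq (inner f f) 0.
  suff -> : inner f g = 0 by rewrite expr0n/= ff0 mul0r.
  apply/eqP; apply/negPn/negP => fg0.
  (* The coefficient is chosen so that the affine expression equals -1. *)
  have := inner_ge0 (fun x => - (inner g g + 1) / (2 * inner f g) * f x + g x).
  rewrite inner_sqr_lin// ff0 mulr0 add0r.
  by rewrite (_ : _ + _ = -1) ?ler0N1//; field.
have ff_gt0 : 0 < inner f f by rewrite lt_def ff_neq0 inner_ge0.
(* The coefficient minimizes the quadratic. *)
have := inner_ge0 (fun x => - inner f g / inner f f * f x + g x).
rewrite inner_sqr_lin// (_ : _ + _ + _ =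
  (inner f f * inner g g - inner f g ^+ 2) / inner f f); last by field.
by rewrite pmulr_lge0 ?invr_gt0// subr_ge0.
Qed.

Lemma inner_eq0 f : f \in Lfun m 2%:E -> inner f f = 0 -> f = cst 0 %[ae m].
Proof.
move=> /Lfun2P[mf fi] f0.
have : (\int[m]_x `|(f x ^+ 2)%:E| = 0)%E.
  rewrite -(fineK (integrable_fin_num measurableT (integrable_abse fi))).
  congr EFin; rewrite -[RHS]f0; congr fine; apply: eq_integral => x _ /=.
  by rewrite ger0_norm ?sqr_ge0.
move/ae_eq_integral_abs => /(_ measurableT) [].
  by apply/measurable_EFinP; exact: measurable_funX.
move=> N [mN N0 sN]; exists N; split=> //; apply: subset_trans sN => x /=.
by apply: contra_not => /(_ I)[/eqP]; rewrite sqrf_eq0 => /eqP fx _.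
Qed.

Section limits.
Context (I : Type) (F : set_system I) {FF : ProperFilter F}.
Implicit Types u v : I -> T -> R.

(** Cauchy-Schwarz and a squeeze. Membership in L^2 is asked only eventually, because a difference
    quotient at time [t] makes sense only while [t + s] is positive. *)
Lemma cvg_inner0 u g : (\forall i \near F, u i \in Lfun m 2%:E) ->
  g \in Lfun m 2%:E -> inner (u i) (u i) @[i --> F] --> (0 : R) ->
  inner (u i) g @[i --> F] --> (0 : R).
Proof.
move=> uL gL u0; apply/norm_cvg0P.
have : Num.sqrt (inner (u i) (u i) * inner g g) @[i --> F] --> (0 : R).
  rewrite -[X in _ --> X](sqrtr0 R); apply: continuous_cvg.
    exact: sqrt_continuous.
  by rewrite -(mul0r (inner g g)); apply: cvgMr_tmp.
apply: squeeze_cvgr; last exact: cvg_cst.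
near=> i; rewrite normr_ge0/= -sqrtr_sqr ler_sqrt.
  by apply: cauchy_schwarz => //; near: i.
by rewrite mulr_ge0 ?inner_ge0.
Unshelve. all: by end_near. Qed.

(** Expanding [|v - u|^2 >= 0] gives [|u + v|^2 <= 2 |u|^2 + 2 |v|^2], so squared norms suffice and
    no triangle inequality is involved. *)
Lemma cvg_inner_sqrD0 u v : (\forall i \near F, u i \in Lfun m 2%:E) ->
  (\forall i \near F, v i \in Lfun m 2%:E) ->
  inner (u i) (u i) @[i --> F] --> (0 : R) ->
  inner (v i) (v i) @[i --> F] --> (0 : R) ->
  inner (u i \+ v i) (u i \+ v i) @[i --> F] --> (0 : R).
Proof.
move=> uL vL u0 v0.
have : 2 * inner (u i) (u i) + 2 * inner (v i) (v i) @[i --> F] --> (0 : R).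
  by rewrite -[X in _ --> X]addr0 -(mulr0 2); apply: cvgD; apply: cvgMl_tmp.
apply: squeeze_cvgr; last exact: cvg_cst.
near=> i; rewrite inner_ge0/=.
have uiL : u i \in Lfun m 2%:E by near: i.
have viL : v i \in Lfun m 2%:E by near: i.
have := inner_ge0 (fun x => -1 * u i x + v i x); rewrite inner_sqr_lin//.
rewrite (_ : u i \+ v i = fun x => 1 * u i x + v i x); last first.
  by apply/funext => x /=; rewrite mul1r.
rewrite inner_sqr_lin//; lra.
Unshelve. all: by end_near. Qed.

End limits.
End square_integrable.

(** * Solutions of the heat equation in L^2 and their uniqueness *)

Section heat_flow.
Context (R : realType) d (T : topMeasurableType d) (X : MMD R T).
Local Notation m := (mmd_meas X).
Implicit Types (f g h : T -> R) (u v w : R -> T -> R).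

(** The clause of [heat_semigroup] for a single initial datum, detached from the operator, so that
    explicitly constructed curves can be compared with the heat flow. *)
Definition heat_solution f u : Prop :=
  (forall t : R, 0 < t -> exists2 h, generator X (u t) h &
     sqnorm X (fun x => (u (t + s) x - u t x) / s - h x) @[s --> (0 : R)^']
     --> (0 : R)) /\
  sqnorm X (u t \- f) @[t --> (0 : R)^'+] --> (0 : R).

Lemma heat_is_solution f : f \in Lfun m 2%:E ->
  heat_solution f (fun t => heat X t f).
Proof. exact: (hk_semigroup (mmd_heat X)). Qed.

Lemma generatorB f g h k : generator X f h -> generator X g k ->
  generator X (f \- g) (h \- k).
Proof.
case=> fD hL fE [gD kL gE]; have Xd := mmd_dirichlet X.
have fgE : f \- g = cst (-1) \* g \+ f by apply/funext => x /=; ring.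
split; [by rewrite fgE; exact: df_lin|exact: Lfun2B|move=> e eD].
have eL := df_L2 Xd eD.
have := innerBl hL kL eL; rewrite /inner => ->.
by rewrite fgE df_bilin// gE// fE//; ring.
Qed.

Lemma heat_solution_Lfun f u t : heat_solution f u -> 0 < t ->
  u t \in Lfun m 2%:E.
Proof. by move=> [uh _] /uh[h [uD _ _] _]; exact: df_L2 (mmd_dirichlet X) _ uD. Qed.

Lemma near0_shift_gt0 (t : R) : 0 < t -> \forall s \near (0 : R)^', 0 < t + s.
Proof.
move=> t0; near=> s; rewrite -ltrBlDl sub0r.
have : `|s| < t by near: s; exact: dnbhs0_lt.
by rewrite ltr_norml => /andP[].
Unshelve. all: by end_near. Qed.

Lemma heat_solution_quotient f u t h : heat_solution f u -> 0 < t ->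
    h \in Lfun m 2%:E ->
  \forall s \near (0 : R)^',
    (fun x => (u (t + s) x - u t x) / s - h x) \in Lfun m 2%:E.
Proof.
move=> us t0 hL; near=> s; have ts : 0 < t + s by near: s; exact: near0_shift_gt0.
apply: Lfun2B => //.
rewrite (_ : (fun x => _) = fun x => s^-1 * (u (t + s) \- u t) x).
  by apply: Lfun2Z; apply: Lfun2B; exact: heat_solution_Lfun us _.
by apply/funext => x /=; rewrite mulrC.
Unshelve. all: by end_near. Qed.

Lemma heat_solutionB f g u v : f \in Lfun m 2%:E -> g \in Lfun m 2%:E ->
  heat_solution f u -> heat_solution g v ->
  heat_solution (f \- g) (fun t => u t \- v t).
Proof.
move=> fL gL us vs; split=> [t t0|].
  have [h uh hlim] := us.1 _ t0; have [k vk klim] := vs.1 _ t0.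
  exists (h \- k); first exact: generatorB.
  have [_ hL _] := uh; have [_ kL _] := vk.
  have uL := heat_solution_quotient us t0 hL.
  have vL := heat_solution_quotient vs t0 kL.
  have klim' : inner m (fun x => -1 * ((v (t + s) x - v t x) / s - k x))
    (fun x => -1 * ((v (t + s) x - v t x) / s - k x)) @[s --> (0 : R)^'] --> (0 : R).
    move: klim; apply: cvg_trans; apply: near_eq_cvg; near=> s.
    have vsL : (fun x => (v (t + s) x - v t x) / s - k x) \in Lfun m 2%:E.
      by near: s.
    rewrite innerZl//; last exact: Lfun2Z.
    rewrite innerC innerZl// mulrA mulrNN !mulr1 mul1r.
    by apply: eq_Rintegral => x _; rewrite expr2.
  have vL' : \forall s \near (0 : R)^', (fun x => -1 *
      ((v (t + s) x - v t x) / s - k x)) \in Lfun m 2%:E.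
    by apply: filterS vL => s; exact: Lfun2Z.
  apply: cvg_trans (cvg_inner_sqrD0 uL vL' hlim klim').
  apply: near_eq_cvg; near=> s.
  by apply: eq_Rintegral => x _ /=; ring.
have uL : \forall t \near (0 : R)^'+, u t \- f \in Lfun m 2%:E.
  near=> t; apply: Lfun2B => //; apply: heat_solution_Lfun us _.
  by near: t; exact: nbhs_right_gt.
have vL : \forall t \near (0 : R)^'+, g \- v t \in Lfun m 2%:E.
  near=> t; apply: Lfun2B => //; apply: heat_solution_Lfun vs _.
  by near: t; exact: nbhs_right_gt.
have vlim : inner m (g \- v t) (g \- v t) @[t --> (0 : R)^'+] --> (0 : R).
  move: vs.2; apply: cvg_trans; apply: near_eq_cvg; near=> t.
  by apply: eq_Rintegral => x _ /=; ring.
apply: cvg_trans (cvg_inner_sqrD0 uL vL us.2 vlim).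
apply: near_eq_cvg; near=> t.
by apply: eq_Rintegral => x _ /=; ring.
Unshelve. all: by end_near. Qed.

Lemma heat_solution_shift f u t : heat_solution f u -> 0 < t ->
  \forall s \near (0 : R)^', u (t + s) \- u t \in Lfun m 2%:E.
Proof.
move=> us t0; near=> s; have ts : 0 < t + s by near: s; exact: near0_shift_gt0.
by apply: Lfun2B; exact: heat_solution_Lfun us _.
Unshelve. all: by end_near. Qed.

(** With [q s] the error of the difference quotient, [u (t + s) - u t] is [s (q s + h)], whose
    squared norm is [s^2] times a bounded quantity. The lemma controls the cross terms in the
    product rule for tensors. *)
Lemma heat_solution_continuous f u t : heat_solution f u -> 0 < t ->
  inner m (u (t + s) \- u t) (u (t + s) \- u t) @[s --> (0 : R)^'] --> (0 : R).
Proof.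
move=> us t0; have [h [_ hL _] hlim] := us.1 _ t0.
pose q s x := (u (t + s) x - u t x) / s - h x.
have qL : \forall s \near (0 : R)^', q s \in Lfun m 2%:E.
  exact: heat_solution_quotient us t0 hL.
have qlim : inner m (q s) (q s) @[s --> (0 : R)^'] --> (0 : R) by [].
have qhlim : inner m (q s) h @[s --> (0 : R)^'] --> (0 : R).
  exact: cvg_inner0.
have s0 : s @[s --> (0 : R)^'] --> (0 : R) by apply: cvg_within.
have : s * (s * (inner m (q s) (q s) + 2 * inner m (q s) h + inner m h h))
    @[s --> (0 : R)^'] --> (0 : R).
  rewrite -[X in _ --> X](mul0r (0 * (0 + 2 * 0 + inner m h h))).
  apply: cvgM => //; apply: cvgM => //.
  by apply: cvgD; [apply: cvgD => //; exact: cvgMl_tmp|exact: cvg_cst].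
apply: cvg_trans; apply: near_eq_cvg; near=> s.
have s_neq0 : s != 0 by near: s; exact: nbhs_dnbhs_neq.
have qsL : q s \in Lfun m 2%:E by near: s.
have -> : u (t + s) \- u t = fun x => s * (1 * q s x + h x).
  by apply/funext => x; rewrite /q /=; field.
have qhL := Lfun2_lin 1 qsL hL.
rewrite innerZl//; last exact: Lfun2Z.
by rewrite [X in _ = _ * X]innerC innerZl// inner_sqr_lin//; ring.
Unshelve. all: by end_near. Qed.

(* The energy estimate d/dt |w_t|^2 = - 2 E(w_t, w_t) <= 0. *)
Lemma heat_solution_derive f w t : heat_solution f w -> 0 < t ->
  derivable (fun t => sqnorm X (w t)) t 1 /\
  derive1 (fun t => sqnorm X (w t)) t <= 0.
Proof.
move=> ws t0; have [h [wD hL wE] hlim] := ws.1 _ t0.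
have wtL := heat_solution_Lfun ws t0.
have hw : inner m h (w t) <= 0.
  by rewrite -oppr_ge0 -(wE _ wD) df_ge0//; exact: mmd_dirichlet.
pose q s x := (w (t + s) x - w t x) / s - h x.
have qL : \forall s \near (0 : R)^', q s \in Lfun m 2%:E.
  exact: heat_solution_quotient ws t0 hL.
have qlim : inner m (q s) (q s) @[s --> (0 : R)^'] --> (0 : R) by [].
have qwlim : inner m (q s) (w t) @[s --> (0 : R)^'] --> (0 : R).
  exact: cvg_inner0.
have qhlim : inner m (q s) h @[s --> (0 : R)^'] --> (0 : R).
  exact: cvg_inner0.
have s0 : s @[s --> (0 : R)^'] --> (0 : R) by apply: cvg_within.
have Wlim : s^-1 * (sqnorm X (w (s + t)) - sqnorm X (w t)) @[s --> (0 : R)^']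
    --> 2 * inner m h (w t).
  have : s * (inner m (q s) (q s) + 2 * inner m (q s) h + inner m h h) +
      (2 * inner m (q s) (w t) + 2 * inner m h (w t)) @[s --> (0 : R)^']
      --> 2 * inner m h (w t).
    rewrite -[X in _ --> X]add0r; apply: cvgD.
      rewrite -[X in _ --> X](mul0r (0 + 2 * 0 + inner m h h)); apply: cvgM => //.
      by apply: cvgD; [apply: cvgD => //; exact: cvgMl_tmp|exact: cvg_cst].
    rewrite -[X in _ --> X]add0r; apply: cvgD; last exact: cvg_cst.
    by rewrite -[X in _ --> X](mulr0 2); exact: cvgMl_tmp.
  apply: cvg_trans; apply: near_eq_cvg; near=> s.
  have s_neq0 : s != 0 by near: s; exact: nbhs_dnbhs_neq.
  have qsL : q s \in Lfun m 2%:E by near: s.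
  have -> : sqnorm X (w (s + t)) =
      inner m (fun x => s * (1 * q s x + h x) + w t x)
              (fun x => s * (1 * q s x + h x) + w t x).
    by apply: eq_Rintegral => x _; rewrite /q addrC; field.
  have qhL := Lfun2_lin 1 qsL hL.
  rewrite inner_sqr_lin// inner_sqr_lin// inner_lin//.
  have -> : sqnorm X (w t) = inner m (w t) (w t).
    by apply: eq_Rintegral => x _; rewrite expr2.
  by field.
split.
  apply/cvg_ex; exists (2 * inner m h (w t)); move: Wlim; apply: cvg_trans.
  apply: near_eq_cvg; near=> s.
  by rewrite /= /GRing.scale/= mulr1.
rewrite /derive1 (cvg_lim _ Wlim)//.
by rewrite pmulr_rle0.
Unshelve. all: by end_near. Qed.

(** The value of the nonincreasing function [|w|^2] at [t] is bounded by its values near 0, which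
    tend to 0. *)
Lemma heat_solution0 w t : heat_solution (cst 0) w -> 0 < t ->
  w t = cst 0 %[ae m].
Proof.
move=> ws t0; have wL := heat_solution_Lfun ws t0.
apply: inner_eq0 => //.
pose W t := sqnorm X (w t).
suff : W t <= 0.
  move=> Wt; apply/eqP; rewrite eq_le inner_ge0 andbT; move: Wt.
  by congr (_ <= _); apply: eq_Rintegral => x _; rewrite expr2.
have W_der s : 0 < s -> derivable W s 1 /\ derive1 W s <= 0.
  exact: heat_solution_derive ws.
have Wle s : 0 < s <= t -> W t <= W s.
  (* The right end [t + 1] keeps [t] inside the open interval on which monotonicity is derived. *)
  move=> /andP[s0 st]; have t2 : t < t + 1 by rewrite ltrDl.
  have d1 x : x \in `]0, (t + 1)[ -> 0 < x by rewrite in_itv => /andP[].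
  apply: (@ler0_derive1_le_oo _ W 0 (t + 1)) => //.
  - by move=> x /d1 /W_der[].
  - by move=> x /d1 /W_der[].
  - move=> x; rewrite inE => /= /d1 /W_der[+ _].
    by move=> /derivable1_diffP/differentiable_continuous.
  - by rewrite in_itv/= t0.
  - by rewrite in_itv/= s0/= (le_lt_trans st).
have : W s @[s --> (0 : R)^'+] --> (0 : R).
  move: ws.2; apply: cvg_trans; apply: near_eq_cvg; near=> s.
  by apply: eq_Rintegral => x _ /=; rewrite subr0.
move/cvgr_to_ge; apply; near=> s; apply: Wle.
by apply/andP; split; near: s; [exact: nbhs_right_gt|exact: nbhs_right_le].
Unshelve. all: by end_near. Qed.

Lemma heat_solution_heat f u t : f \in Lfun m 2%:E -> heat_solution f u ->
  0 < t -> u t = heat X t f %[ae m].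
Proof.
move=> fL us t0.
have := heat_solutionB fL fL us (heat_is_solution fL).
rewrite (_ : f \- f = cst 0); last by apply/funext => x /=; rewrite subrr.
move=> /heat_solution0 /(_ t0) [N [mN N0 sN]]; exists N; split=> //.
apply: subset_trans sN => x /=; apply: contra_not => /(_ I) /eqP.
by rewrite subr_eq0 => /eqP.
Qed.

End heat_flow.

(** * Borel measurability *)

Section borel.
Context (R : realType) d (T : topMeasurableType d).

Lemma borel_open (X : MMD R T) (U : set T) : open U -> measurable U.
Proof.
by rewrite (mm_borel (mmd_metric_measure X)) => oU; exact: sub_sigma_algebra.
Qed.

Lemma continuous_measurable (X : MMD R T) (f : T -> R) :
  continuous f -> measurable_fun setT f.
Proof.
move=> cf; apply: (measurability _ (RGenOInfty.measurableE R)) => _ [_ [x ->] <-].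
rewrite setTI; apply: (borel_open X); exact: open_comp.
Qed.

(** The spaces [X] and [Y] are arguments because their [mm_borel] is what links the two
    sigma-algebras to the topologies. *)
Lemma continuous_measurable_map d' (T' : topMeasurableType d') (X : MMD R T)
    (Y : MMD R T') (phi : T -> T') :
  continuous phi -> measurable_fun setT phi.
Proof.
move=> cphi.
apply: (measurability _ (mm_borel (mmd_metric_measure Y))) => _ [U oU <-].
rewrite setTI; apply: (borel_open X).
by move/continuousP: cphi; exact.
Qed.

End borel.

(** * Identification of a heat kernel by its action on small open sets *)

Section kernel.
Context (R : realType) d (T : topMeasurableType d) (X : MMD R T).
Local Notation m := (mmd_meas X).
Local Notation p := (mmd_kernel X).
Implicit Types (x y z : T) (t s : R) (f : T -> R) (B : set T).

Definition finite_open : set (set T) :=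
  [set B | open B /\ (m B < +oo)%E].

(** A ball of radius at most 1 lies in the closed unit ball, which is compact by properness and so
    has finite Radon measure. *)
Lemma finite_open_nbhs z (V : set T) : nbhs z V ->
  exists B, [/\ finite_open B, B z & B `<=` V].
Proof.
have [metr proper _ _ _ [compact_fin _] _] := mmd_metric_measure X.
have [dist0 _ distD nbhsE] := metr.
rewrite nbhsE => -[e /= e0 eV]; pose r := Num.min e 1.
have r0 : 0 < r by rewrite lt_min e0 ltr01.
have ballo : open [set y | mmd_dist X z y < r].
  rewrite openE => y /= zy; rewrite /interior nbhsE.
  exists (r - mmd_dist X z y); first by rewrite /= subr_gt0.
  by move=> w /= yw; apply: le_lt_trans (distD z y w) _; rewrite -ltrBrDl.
exists [set y | mmd_dist X z y < r]; split.
- split=> //; have K := proper z 1; apply: le_lt_trans (compact_fin _ K).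
  apply: le_measure; rewrite ?inE; first exact: (borel_open X).
    rewrite -(setCK [set y | mmd_dist X z y <= 1]).
    apply: measurableC; apply: (borel_open X).
    rewrite openE => y /= /negP; rewrite -ltNge => zy; rewrite /interior nbhsE.
    exists (mmd_dist X z y - 1); first by rewrite /= subr_gt0.
    move=> w /= yw; apply/negP; rewrite -ltNge.
    have [_ dsym _ _] := metr; have := distD z w y; rewrite (dsym w y).
    by move=> ?; lra.
  by move=> y /= /ltW /le_trans; apply; rewrite ge_min lexx orbT.
- by rewrite /= (dist0 z z).2.
- by move=> y /= zy; apply: eV => /=; apply: lt_le_trans zy _; rewrite ge_min lexx.
Qed.

Lemma finite_open_measurable B : finite_open B -> measurable B.
Proof. by case=> oB _; exact: (borel_open X). Qed.

Lemma Lfun2_indic B : finite_open B -> \1_B \in Lfun m 2%:E.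
Proof.
move=> /[dup] fB [oB Bfin]; have mB := finite_open_measurable fB.
apply/Lfun2P; split; first exact: measurable_indic.
apply/integrableP; split.
  by apply/measurable_EFinP; apply: measurable_funX; exact: measurable_indic.
rewrite (eq_integral (fun x => (\1_B x)%:E)); first by rewrite integral_indic// setIT.
move=> x _ /=; rewrite indicE; case: (x \in B) => /=.
  by rewrite expr1n normr1.
by rewrite expr0n normr0.
Qed.

Lemma kernel_ge0 t x y : 0 < t -> 0 <= p t x y.
Proof. by move=> t0; apply/ltW/(hk_gt0 (mmd_heat X)). Qed.

Lemma kernel_continuous2 t : 0 < t -> continuous (fun z : T * T => p t z.1 z.2).
Proof.
move=> t0 [x y].
have c : {for (x, y), continuous (fun z : T * T => (t, z.1, z.2))}.
  apply: (@cvg_pair _ _ _ _ (nbhs (t, x)) (nbhs y)) => /=; last exact: cvg_snd.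
  apply: (@cvg_pair _ _ _ _ (nbhs t) (nbhs x)) => /=; last exact: cvg_fst.
  exact: cvg_cst.
exact: (continuous_comp c (@hk_continuous _ _ _ _ (mmd_heat X) t x y t0)).
Qed.

Lemma kernel_measurable t x : 0 < t -> measurable_fun setT (p t x).
Proof.
move=> t0; apply: (continuous_measurable X) => y.
have c : {for y, continuous (fun y => (x, y))}.
  apply: (@cvg_pair _ _ _ _ (nbhs x) (nbhs y)) => /=; last exact: cvg_id.
  exact: cvg_cst.
exact: (continuous_comp c (@kernel_continuous2 t t0 (x, y))).
Qed.

(** An infinite integral would have real value 0, so a nonzero real value certifies finiteness. This
    extracts integrability from the kernel axioms, which are stated with real integrals. *)
Lemma fine_neq0_integrable f : measurable_fun setT f -> (forall x, 0 <= f x) ->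
  \int[m]_x f x != 0 -> m.-integrable setT (EFin \o f).
Proof.
move=> mf f0 If; apply/integrableP; split; first exact/measurable_EFinP.
under eq_integral do rewrite /= ger0_norm//.
rewrite ltey; apply: contra_neq If => Ioo; first by rewrite /Rintegral Ioo.
Qed.

Lemma kernel_integrable t x : 0 < t -> m.-integrable setT (EFin \o p t x).
Proof.
move=> t0; apply: fine_neq0_integrable; first exact: kernel_measurable.
  by move=> y; exact: kernel_ge0.
by rewrite (hk_conservative (mmd_heat X))// oner_neq0.
Qed.

(** By Chapman-Kolmogorov and symmetry the squared norm is [p (t + t) x x], which is positive and
    hence not a default value. *)
Lemma kernel_Lfun2 t x : 0 < t -> p t x \in Lfun m 2%:E.
Proof.
move=> t0; apply/Lfun2P; split; first exact: kernel_measurable.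
apply: fine_neq0_integrable.
- by apply: measurable_funX; exact: kernel_measurable.
- by move=> y; rewrite sqr_ge0.
have <- : p (t + t) x x = \int[m]_y p t x y ^+ 2.
  rewrite (hk_chapman_kolmogorov (mmd_heat X))//; apply: eq_Rintegral => y _.
  by rewrite (hk_sym (mmd_heat X) y x t0).
by rewrite gt_eqF// (hk_gt0 (mmd_heat X))// addr_gt0.
Qed.

Lemma heat_indic t B x : heat X t \1_B x = \int[m]_(y in B) p t x y.
Proof.
rewrite Rintegral_mkcond; apply: eq_Rintegral => y _.
by rewrite patchE indicE; case: (y \in B); rewrite ?mulr1 ?mulr0.
Qed.

(** If [K < K'] at a point, then by continuity also on a product [W x B] with [B] in the base. For
    some [z] in [W] the integrals over [B] agree, so the positive function [K' z - K z] has integral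
    0 over [B], against full support. Only one [B] occurs, so its null set does no harm. *)
Lemma kernel_le (base : set (set T)) (K K' : T -> T -> R) :
    (forall z V, nbhs z V -> exists B, [/\ base B, open B, B z & B `<=` V]) ->
    continuous (fun z : T * T => K z.1 z.2) ->
    continuous (fun z : T * T => K' z.1 z.2) ->
    (forall z, m.-integrable setT (EFin \o K z)) ->
    (forall z, m.-integrable setT (EFin \o K' z)) ->
    (forall B, base B ->
      {ae m, forall z, \int[m]_(y in B) K z y = \int[m]_(y in B) K' z y}) ->
  forall z z', K' z z' <= K z z'.
Proof.
move=> baseP cK cK' iK iK' KK' z0 z1; rewrite leNgt; apply/negP => lt01.
pose D (z : T * T) := K' z.1 z.2 - K z.1 z.2.
have cD : continuous D by move=> z; apply: cvgB; [exact: cK'|exact: cK].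
have : nbhs (z0, z1) [set z | 0 < D z].
  apply: (cD (z0, z1) [set r | 0 < r]); apply: open_nbhs_nbhs.
  by split; [exact: open_gt|rewrite /= subr_gt0].
case=> -[U V] /= [Uz0 Vz1] UV.
have [B [baseB oB Bz1 BV]] := baseP _ _ Vz1.
have [N [mN N0 sN]] := KK' _ baseB.
move: Uz0; rewrite nbhsE => -[W [oW Wz0] WU].
(* A nonempty open set has positive measure and cannot lie inside the null set [N]. *)
have [z [Wz Nz]] : exists z, W z /\ ~ N z.
  apply: contrapT => WN; have := mm_full_support (mmd_metric_measure X) oW.
  move=> /(_ (ex_intro _ z0 Wz0)); apply/negP; rewrite -leNgt -N0.
  apply: le_measure; rewrite ?inE//; first exact: (borel_open X).
  by move=> w Ww; apply: contrapT => Nw; exact: WN (ex_intro _ w (conj Ww Nw)).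
have KE : \int[m]_(y in B) K z y = \int[m]_(y in B) K' z y.
  by apply: contrapT => h; apply: Nz; apply: sN.
have mB := borel_open X oB.
have iKB := integrableS measurableT mB (@subsetT _ B) (iK z).
have iKB' := integrableS measurableT mB (@subsetT _ B) (iK' z).
have iD : m.-integrable B (EFin \o (fun y => D (z, y))).
  exact: (integrableB mB iKB' iKB).
have D0 : (\int[m]_(y in B) `|(D (z, y))%:E| = 0)%E.
  rewrite (eq_integral (fun y => (D (z, y))%:E)); last first.
    move=> y; rewrite inE => By /=; rewrite ger0_norm//.
    by apply/ltW/UV; split; [exact: WU|exact: BV].
  rewrite -(fineK (integrable_fin_num mB iD)); congr EFin.
  by have := RintegralB mB iKB' iKB; rewrite KE subrr.
move/ae_eq_integral_abs : D0 => /(_ mB) []; first exact: measurable_int iD.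
move=> N' [mN' N'0 sN'].
have := mm_full_support (mmd_metric_measure X) oB (ex_intro _ z1 Bz1).
apply/negP; rewrite -leNgt -N'0; apply: le_measure; rewrite ?inE//.
move=> y By; apply: sN' => /= /(_ By) -[Dzy].
have : 0 < D (z, y) by apply: UV; split; [exact: WU|exact: BV].
by rewrite Dzy ltxx.
Qed.

Lemma kernel_unique (base : set (set T)) (K K' : T -> T -> R) :
    (forall z V, nbhs z V -> exists B, [/\ base B, open B, B z & B `<=` V]) ->
    continuous (fun z : T * T => K z.1 z.2) ->
    continuous (fun z : T * T => K' z.1 z.2) ->
    (forall z, m.-integrable setT (EFin \o K z)) ->
    (forall z, m.-integrable setT (EFin \o K' z)) ->
    (forall B, base B ->
      {ae m, forall z, \int[m]_(y in B) K z y = \int[m]_(y in B) K' z y}) ->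
  forall z z', K z z' = K' z z'.
Proof.
move=> baseP cK cK' iK iK' KK' z z'; apply/eqP; rewrite eq_le.
rewrite (kernel_le baseP cK cK' iK iK')//.
rewrite (kernel_le baseP cK' cK iK' iK)// => B /KK'.
by apply: filterS => w ->.
Qed.

(** The base is left as a parameter: preimages of open sets are used for a change of space,
    rectangles for a product. *)
Lemma heat_kernel_unique (base : set (set T)) (q : R -> T -> T -> R) :
    (forall z V, nbhs z V -> exists B, [/\ base B, open B, B z & B `<=` V]) ->
    (forall t, 0 < t -> continuous (fun z : T * T => q t z.1 z.2)) ->
    (forall t z, 0 < t -> m.-integrable setT (EFin \o q t z)) ->
    (forall B, base B -> \1_B \in Lfun m 2%:E /\
      exists2 u, heat_solution X \1_B u &
        forall t z, 0 < t -> \int[m]_(y in B) q t z y = u t z) ->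
  forall t x y, 0 < t -> p t x y = q t x y.
Proof.
move=> baseP cq iq qP t x y t0; apply: (kernel_unique baseP).
- exact: kernel_continuous2.
- exact: cq.
- by move=> z; exact: kernel_integrable.
- by move=> z; exact: iq.
move=> B /qP[BL [u uB qu]]; have := heat_solution_heat BL uB t0.
by apply: filterS => z /= /(_ I); rewrite heat_indic qu// => ->.
Qed.

Lemma heat_cst t (c : R) x : 0 < t -> heat X t (cst c) x = c.
Proof.
move=> t0; rewrite /heat RintegralZr//; last exact: kernel_integrable.
by rewrite (hk_conservative (mmd_heat X))// mul1r.
Qed.

End kernel.

(** * Integrals under a map that multiplies the measure by a constant *)

Section image_measure.
Context (R : realType) d1 d2 (T1 : measurableType d1) (T2 : measurableType d2).
Context (m1 : {measure set T1 -> \bar R}) (m2 : {measure set T2 -> \bar R}).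
Context (phi : T1 -> T2) (k : R).
Hypotheses (k_gt0 : 0 < k) (mphi : measurable_fun setT phi).
Hypothesis m1phi : forall A, measurable A -> m1 (phi @^-1` A) = (k%:E * m2 A)%E.

Let knng : {nonneg R} := NngNum (ltW k_gt0).

Lemma ge0_integral_image (F : T2 -> \bar R) : measurable_fun setT F ->
  (forall y, 0 <= F y)%E ->
  (\int[m1]_x F (phi x) = k%:E * \int[m2]_y F y)%E.
Proof.
move=> mF F0.
have := ge0_integral_pushforward mphi m1 measurableT mF.
rewrite preimage_setT => <-; last by move=> y _; exact: F0.
rewrite -(@ge0_integral_mscale _ _ _ m2 _ measurableT knng F mF); last first.
  by move=> y _; exact: F0.
by apply: eq_measure_integral => A mA _; exact: m1phi mA.
Qed.

Lemma integrable_image (F : T2 -> R) : m2.-integrable setT (EFin \o F) ->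
  m1.-integrable setT (EFin \o F \o phi).
Proof.
move=> /integrableP[mF Foo]; apply/integrableP; split.
  exact: measurableT_comp.
rewrite (ge0_integral_image (F := fun y => `|(EFin \o F) y|%E))//.
  by rewrite lte_mul_pinfty// lee_fin ltW.
exact: measurableT_comp.
Qed.

(* Both sides are 0 by convention when an integral diverges. *)
Lemma Rintegral_image (F : T2 -> R) : measurable_fun setT F ->
  \int[m1]_x F (phi x) = k * \int[m2]_y F y.
Proof.
move=> /measurable_EFinP mF; rewrite /Rintegral.
have -> : (\int[m1]_x (F (phi x))%:E = k%:E * \int[m2]_y ((EFin \o F)^\+ y) -
    k%:E * \int[m2]_y ((EFin \o F)^\- y))%E.
  rewrite -!ge0_integral_image//; [|exact: measurable_funeneg|exact: measurable_funepos].
  rewrite integralE; congr (_ - _)%E.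
    by apply: eq_integral => x _; rewrite !funeposE.
  by apply: eq_integral => x _; rewrite !funenegE.
rewrite [in RHS]integralE.
have : (0 <= \int[m2]_y ((EFin \o F)^\+ y))%E by exact: integral_ge0.
have : (0 <= \int[m2]_y ((EFin \o F)^\- y))%E by exact: integral_ge0.
move: (integral _ _ _) => A; move: (integral _ _ _) => B.
case: A => [a| |] //; case: B => [b| |] //= _ _;
  rewrite ?gt0_muley ?lte_fin//= ?mulr0//.
by rewrite mulrBr.
Qed.

Lemma Lfun2_image (F : T2 -> R) : F \in Lfun m2 2%:E ->
  F \o phi \in Lfun m1 2%:E.
Proof.
move=> /Lfun2P[mF iF]; apply/Lfun2P; split; first exact: measurableT_comp.
exact: integrable_image iF.
Qed.

Lemma inner_image (F G : T2 -> R) : F \in Lfun m2 2%:E -> G \in Lfun m2 2%:E ->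
  inner m1 (F \o phi) (G \o phi) = k * inner m2 F G.
Proof.
move=> FL GL; apply: (Rintegral_image (F := fun y => F y * G y)).
exact: measurable_funM (Lfun2_measurable FL) (Lfun2_measurable GL).
Qed.

End image_measure.

Lemma continuous_prod_map (S1 S2 S3 S4 : topologicalType) (f : S1 -> S3)
    (g : S2 -> S4) : continuous f -> continuous g ->
  continuous (fun z : S1 * S2 => (f z.1, g z.2)).
Proof.
move=> cf cg z; apply: (@cvg_pair _ _ _ _ (nbhs (f z.1)) (nbhs (g z.2))).
  by apply: (@continuous_comp _ _ _ fst f z); [exact: cvg_fst|exact: cf].
by apply: (@continuous_comp _ _ _ snd g z); [exact: cvg_snd|exact: cg].
Qed.

(** * Limits at 0 under a dilation of time *)

Section scale.
Context (R : realType) (l : R).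
Hypothesis l_gt0 : 0 < l.

Let cvg_scale : (l * s) @[s --> (0 : R)] --> (0 : R).
Proof. by rewrite -[X in _ --> X](mulr0 l); exact: cvgMl_tmp. Qed.

Lemma cvg_scale_dnbhs : (l * s) @[s --> (0 : R)^'] --> (0 : R)^'.
Proof.
move=> A A0; change (\forall s \near (0 : R), s != 0 -> A (l * s)).
have : \forall s \near (0 : R), l * s != 0 -> A (l * s) := cvg_scale A0.
by apply: filterS => s + s0; apply; rewrite mulf_neq0// gt_eqF.
Qed.

Lemma cvg_scale_right : (l * s) @[s --> (0 : R)^'+] --> (0 : R)^'+.
Proof.
move=> A A0; change (\forall s \near (0 : R), 0 < s -> A (l * s)).
have : \forall s \near (0 : R), 0 < l * s -> A (l * s) := cvg_scale A0.
by apply: filterS => s + s0; apply; rewrite mulr_gt0.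
Qed.

End scale.

(** * Heat flow, kernel and entropy under an isomorphism up to scale *)

Section transport.
Context (R : realType) d1 d2 (T1 : topMeasurableType d1)
  (T2 : topMeasurableType d2) (X : MMD R T1) (Y : MMD R T2).
Context (phi : T1 -> T2) (psi : T2 -> T1) (k l : R).
Hypotheses (k_gt0 : 0 < k) (l_gt0 : 0 < l).
Hypothesis phiK : cancel phi psi.
Hypotheses (cphi : continuous phi) (cpsi : continuous psi).
Hypothesis meas_phi : forall A, measurable A ->
  mmd_meas X (phi @^-1` A) = (k%:E * mmd_meas Y A)%E.
Hypothesis dom_phi : forall f, mmd_dom Y f <-> mmd_dom X (f \o phi).
Hypothesis form_phi : forall f g, mmd_dom Y f -> mmd_dom Y g ->
  mmd_form X (f \o phi) (g \o phi) = k * l * mmd_form Y f g.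

Local Notation mX := (mmd_meas X).
Local Notation mY := (mmd_meas Y).

Let mphi : measurable_fun setT phi.
Proof. exact: (continuous_measurable_map X Y). Qed.

(** The factor [k] enters both the form and the inner product and cancels, leaving [l]. Composition
    with [psi] shows that every test function on [X] comes from one on [Y]. *)
Lemma generator_transport (f h : T2 -> R) : generator Y f h ->
  generator X (f \o phi) (fun x => l * h (phi x)).
Proof.
move=> [fD hL fE]; split; first exact/dom_phi.
  by apply: (@Lfun2Z _ _ _ mX l (h \o phi)); exact: (Lfun2_image k_gt0 mphi meas_phi).
move=> g gD; pose g' := g \o psi.
have gE : g = g' \o phi by apply/funext => x; rewrite /g'/= phiK.
have gD' : mmd_dom Y g' by apply/dom_phi; rewrite -gE.
have gL := df_L2 (mmd_dirichlet Y) gD'.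
rewrite gE form_phi// fE//.
have := @innerZl _ _ _ mX l _ _ (Lfun2_image k_gt0 mphi meas_phi hL)
  (Lfun2_image k_gt0 mphi meas_phi gL).
rewrite (inner_image k_gt0 mphi meas_phi)// /inner => ->; ring.
Qed.

Lemma sqnorm_transport (f : T2 -> R) : f \in Lfun mY 2%:E ->
  sqnorm X (f \o phi) = k * sqnorm Y f.
Proof.
move=> /Lfun2_measurable mf.
by apply: (Rintegral_image k_gt0 mphi meas_phi); exact: measurable_funX.
Qed.

Lemma heat_solution_transport f u : f \in Lfun mY 2%:E ->
  heat_solution Y f u -> heat_solution X (f \o phi) (fun t => u (l * t) \o phi).
Proof.
move=> fL us; split=> [t t0|].
  have lt0 : 0 < l * t by rewrite mulr_gt0.
  have [h uh hlim] := us.1 _ lt0; exists (fun x => l * h (phi x)).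
    exact: generator_transport.
  have [_ hL _] := uh; have uL := heat_solution_quotient us lt0 hL.
  (* By the chain rule in time the error of the quotient on [X] is [l] times the one on [Y];
     squaring gives [l ^+ 2], and the change of variables gives [k]. *)
  have : l ^+ 2 * k * sqnorm Y (fun x =>
      (u (l * t + l * s) x - u (l * t) x) / (l * s) - h x) @[s --> (0 : R)^']
      --> (0 : R).
    rewrite -[X in _ --> X](mulr0 (l ^+ 2 * k)); apply: cvgMl_tmp.
    exact: cvg_comp (cvg_scale_dnbhs l_gt0) hlim.
  apply: cvg_trans; apply: near_eq_cvg; near=> s.
  have quotL : (fun x => (u (l * t + l * s) x - u (l * t) x) / (l * s) - h x)
      \in Lfun mY 2%:E by near: s; exact: (cvg_scale_dnbhs l_gt0 uL).
  have s_neq0 : s != 0 by near: s; exact: nbhs_dnbhs_neq.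
  rewrite -mulrA -sqnorm_transport//.
  have /Lfun2P[_ iq] := Lfun2_image k_gt0 mphi meas_phi quotL.
  rewrite /sqnorm -RintegralZl//; apply: eq_Rintegral => x _ /=.
  by rewrite mulrDr; field; rewrite s_neq0 gt_eqF.
have : k * sqnorm Y (u (l * t) \- f) @[t --> (0 : R)^'+] --> (0 : R).
  rewrite -[X in _ --> X](mulr0 k); apply: cvgMl_tmp.
  exact: (cvg_comp _ _ (cvg_scale_right l_gt0) us.2).
apply: cvg_trans; apply: near_eq_cvg; near=> t.
rewrite -sqnorm_transport//; apply: Lfun2B => //.
by apply: heat_solution_Lfun us _; rewrite mulr_gt0.
Unshelve. all: by end_near. Qed.

Lemma kernel_transport t x y : 0 < t ->
  mmd_kernel X t x y = k^-1 * mmd_kernel Y (l * t) (phi x) (phi y).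
Proof.
pose base := [set phi @^-1` B | B in finite_open Y].
apply: (@heat_kernel_unique _ _ _ X base (fun t x y =>
  k^-1 * mmd_kernel Y (l * t) (phi x) (phi y))).
- move=> z V Vz; have : nbhs (phi z) (psi @^-1` V).
    by apply: cpsi; rewrite phiK.
  move=> /(finite_open_nbhs Y)[B [[oB Bfin] Bz BV]].
  exists (phi @^-1` B); split=> //; first by exists B.
    by move/continuousP: cphi; exact.
  by move=> w /= /BV /=; rewrite phiK.
- move=> {}t t0; have lt0 : 0 < l * t by rewrite mulr_gt0.
  have c : continuous (fun z : T1 * T1 =>
      mmd_kernel Y (l * t) (phi z.1) (phi z.2)).
    move=> z; apply: (@continuous_comp _ _ _ (fun z => (phi z.1, phi z.2))
      (fun z : T2 * T2 => mmd_kernel Y (l * t) z.1 z.2)).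
      exact: continuous_prod_map.
    exact: kernel_continuous2.
  by move=> z; apply: cvgMl_tmp; exact: c.
- move=> {}t z t0; have lt0 : 0 < l * t by rewrite mulr_gt0.
  exact: (integrableZl measurableT k^-1 (integrable_image k_gt0 mphi meas_phi
    (kernel_integrable Y (phi z) lt0))).
move=> _ [B fB <-]; have BL := Lfun2_indic fB.
have -> : \1_(phi @^-1` B) = \1_B \o phi :> (T1 -> R).
  by apply/funext => z; rewrite /= !indicE.
split; first exact: (Lfun2_image k_gt0 mphi meas_phi).
exists (fun t => heat Y (l * t) \1_B \o phi).
  exact: heat_solution_transport (heat_is_solution BL).
move=> {}t z t0; have lt0 : 0 < l * t by rewrite mulr_gt0.
have ipB := Lfun2_integrableM (kernel_Lfun2 Y (phi z) lt0) BL.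
rewrite Rintegral_mkcond /= /heat.
rewrite -[RHS](mulKf (lt0r_neq0 k_gt0)).
rewrite -(Rintegral_image k_gt0 mphi meas_phi (integrable_measurable ipB)) -RintegralZl//.
  apply: eq_Rintegral => w _; rewrite patchE indicE.
  rewrite -[w \in phi @^-1` B]/(phi w \in B).
  by case: ifP; rewrite ?mulr1 ?mulr0.
exact: (integrable_image k_gt0 mphi meas_phi ipB).
Qed.

(** The factor [k^-1] of the kernel contributes [- ln k] inside the logarithm, against a probability
    density; replacing [t] by [l * t] in the normalization costs [N / 2 * ln l]. *)
Lemma nash_transport N x t : 0 < t ->
  nash X N x t = nash Y N (phi x) (l * t) + (ln k + N / 2 * ln l).
Proof.
move=> t0; have lt0 : 0 < l * t by rewrite mulr_gt0.
pose q := mmd_kernel Y (l * t) (phi x).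
have iq := kernel_integrable Y (phi x) lt0.
have iqlnq := nash_finite (mmd_nash Y) (phi x) lt0.
have iF : mY.-integrable setT (EFin \o (fun y => q y * ln (q y) - ln k * q y)).
  by apply: integrable_EFinB => //; exact: integrable_EFinZl.
have -> : nash X N x t = - (\int[mX]_y (k^-1 * (q (phi y) * ln (q (phi y)) -
    ln k * q (phi y)))) - N / 2 * ln (4 * pi * t) - N / 2.
  rewrite /nash; congr (- _ - _ - _); apply: eq_Rintegral => y _.
  rewrite kernel_transport// lnM ?posrE ?invr_gt0//.
    by rewrite lnV ?posrE// /q; ring.
  exact: (hk_gt0 (mmd_heat Y)).
rewrite RintegralZl//; last exact: (integrable_image k_gt0 mphi meas_phi iF).
rewrite (Rintegral_image k_gt0 mphi meas_phi (integrable_measurable iF)) mulKf ?gt_eqF//.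
rewrite RintegralB//; last exact: integrable_EFinZl.
rewrite RintegralZl// (hk_conservative (mmd_heat Y))// /nash.
have -> : 4 * pi * (l * t) = l * (4 * pi * t) by ring.
by rewrite (@lnM _ l) ?posrE ?mulr_gt0 ?pi_gt0// /q; ring.
Qed.

Lemma nash2_transport N x t s : 0 < N -> 0 < t -> 0 < s ->
  nash2 X N x t s = nash2 Y N (phi x) (l * t) (l * s) + (ln k + N / 2 * ln l).
Proof.
move=> N0 t0 s0; set C := ln k + _.
have lt0 : 0 < l * t by rewrite mulr_gt0.
have ls0 : 0 < l * s by rewrite mulr_gt0.
have iq := kernel_integrable Y (phi x) ls0.
have iN := nash_integrable (mmd_nash Y) (phi x) N0 ls0 lt0.
have iCq := integrable_EFinZl C iq.
pose F y := mmd_kernel Y (l * s) (phi x) y * nash Y N y (l * t) +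
  C * mmd_kernel Y (l * s) (phi x) y.
have iF : mY.-integrable setT (EFin \o F) by exact: integrable_EFinD.
transitivity (\int[mX]_y (k^-1 * F (phi y))).
  apply: eq_Rintegral => y _.
  by rewrite kernel_transport// nash_transport// -/C /F; ring.
rewrite RintegralZl; [|by []|exact: (integrable_image k_gt0 mphi meas_phi iF)].
rewrite (Rintegral_image k_gt0 mphi meas_phi (integrable_measurable iF)) mulKf ?gt_eqF//.
rewrite RintegralD// RintegralZl//.
by rewrite (hk_conservative (mmd_heat Y))// mulr1.
Qed.

End transport.

(** * Additivity of lower integrals up to an integrable function *)

Section lower_integral.
Import HBNNSimple.
Context d (T : measurableType d) (R : realType) (m : {measure set T -> \bar R}).
Implicit Types (F G : T -> \bar R) (k : T -> R).

(** The integral of a nonnegative function is a supremum over the simple functions below it, hence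
    monotone without measurability. *)
Lemma le_integral_nonmeasurable F G : (forall x, 0 <= F x)%E ->
  (forall x, F x <= G x)%E -> (\int[m]_x F x <= \int[m]_x G x)%E.
Proof.
move=> F0 FG; rewrite !ge0_integralTE//; last first.
  by move=> x; exact: le_trans (FG x).
apply: ereal_sup_le => _ [h /= hF <-]; exists h => // x /=.
exact: le_trans (FG x).
Qed.

(** For a simple [h] below [F], the positive part of [h + k] is measurable and lies below [F + k].
    Integrating the pointwise bound [h + k^+ <= (h + k)^+ + k^-] separates [h] from [k]. *)
Lemma ge_integralD_nonmeasurable F k : (forall x, 0 <= F x)%E ->
  (forall x, 0 <= F x + (k x)%:E)%E -> m.-integrable setT (EFin \o k) ->
  (\int[m]_x F x + \int[m]_x (k x)%:E <= \int[m]_x (F x + (k x)%:E))%E.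
Proof.
move=> F0 Fk0 ik; have mk := measurable_int _ ik.
have kfin := integrable_fin_num measurableT ik.
rewrite -leeBrDr// [leLHS]ge0_integralTE//.
apply: ge_ereal_sup => _ [h /= hF <-]; rewrite leeBrDr//.
rewrite -integralT_nnsfun.
have mh : measurable_fun setT (EFin \o h) by exact/measurable_EFinP.
pose hk := (EFin \o (fun x => h x + k x)).
have mhk : measurable_fun setT hk := emeasurable_funD mh mk.
have : (\int[m]_x (hk^\+ x) <= \int[m]_x (F x + (k x)%:E))%E.
  apply: le_integral_nonmeasurable => // x.
  rewrite funeposE ge_max Fk0 andbT /hk /= EFinD.
  by apply: leeD => //; exact: hF.
apply: le_trans.
have -> : (\int[m]_x (k x)%:E = \int[m]_x ((EFin \o k)^\+ x) -
    \int[m]_x ((EFin \o k)^\- x))%E by rewrite -integralE.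
have ip := integrable_pos_fin_num measurableT ik.
have in_ := integrable_neg_fin_num measurableT ik.
rewrite addeA leeBlDr//.
have mkp : measurable_fun setT ((EFin \o k)^\+)%E by exact: measurable_funepos.
have mkn : measurable_fun setT ((EFin \o k)^\-)%E by exact: measurable_funeneg.
rewrite -ge0_integralD//; [|by move=> x _; rewrite lee_fin..].
rewrite -ge0_integralD//; last exact: measurable_funepos.
apply: ge0_le_integral => //.
- by move=> x _; rewrite adde_ge0// lee_fin.
- exact: emeasurable_funD.
- by apply: emeasurable_funD => //; exact: measurable_funepos.
move=> x _; rewrite !funeposE !funenegE /hk /= -!EFin_max -!EFinD lee_fin.
have [] := leP (k x) 0; have [] := leP (- k x) 0; have [] := leP (h x + k x) 0;
  lra.
Qed.

(* [F] need not be measurable, its integral being then a lower integral: nothing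
   says that the energies of the sections of a function are measurable. *)
Lemma integralD_nonmeasurable F k : (forall x, 0 <= F x)%E ->
  (forall x, 0 <= F x + (k x)%:E)%E -> m.-integrable setT (EFin \o k) ->
  (\int[m]_x (F x + (k x)%:E) = \int[m]_x F x + \int[m]_x (k x)%:E)%E.
Proof.
move=> F0 Fk0 ik; apply/eqP; rewrite eq_le ge_integralD_nonmeasurable// andbT.
have kfin := integrable_fin_num measurableT ik.
have iNk : m.-integrable setT (EFin \o (fun x => - k x)).
  exact: (integrableN ik).
have FkK x : (F x + (k x)%:E + (- k x)%:E)%E = F x.
  by rewrite -addeA -EFinD subrr adde0.
have FkK0 x : (0 <= F x + (k x)%:E + (- k x)%:E)%E by rewrite FkK.
(* The reverse inequality is the same statement for [F + k] and [- k], whose sum is [F]. *)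
have := ge_integralD_nonmeasurable Fk0 FkK0 iNk.
under [leRHS]eq_integral do rewrite FkK.
have -> : (\int[m]_x (- k x)%:E = - \int[m]_x (k x)%:E)%E.
  rewrite -integralN//=; last exact: integrable_add_def.
by rewrite leeBlDr.
Qed.

End lower_integral.

(** * Fubini for real integrals, and tensors *)

Section product_integral.
Context d1 d2 (T1 : measurableType d1) (T2 : measurableType d2) (R : realType).
Context (m1 : {sigma_finite_measure set T1 -> \bar R}).
Context (m2 : {sigma_finite_measure set T2 -> \bar R}).
Local Notation mP := (m1 \x m2)%E.
Implicit Types (F : T1 * T2 -> R) (a : T1 -> R) (b : T2 -> R).

(** An integrable function is finite almost everywhere, so [fine] alters it on a null set only. The
    inner integrals of Fubini can thus be taken as real numbers. *)
Lemma integrable_fine d (T : measurableType d) (m : {measure set T -> \bar R})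
    (f : T -> \bar R) : m.-integrable setT f ->
  m.-integrable setT (EFin \o (fun x => fine (f x))) /\
  (\int[m]_x (fine (f x))%:E = \int[m]_x f x)%E.
Proof.
move=> fi; have mf := measurable_int _ fi.
have mff : measurable_fun setT (EFin \o (fun x => fine (f x))).
  by apply/measurable_EFinP; exact: measurableT_comp.
split.
  apply: le_integrable fi => // x _ /=.
  by case: (f x) => [r| |] //=; rewrite ?normr0 ?leey.
apply: ae_eq_integral => //; have := integrable_ae measurableT fi.
by apply: filterS => x /= fx _; rewrite fineK// fx.
Qed.

Lemma integrable_fubini_G (f : T1 * T2 -> \bar R) : mP.-integrable setT f ->
  m2.-integrable setT (fubini_G m1 f).
Proof.
move=> fi; have mf := measurable_int _ fi; have mG := measurable_fubini_G fi.
have mnf : measurable_fun setT (abse \o f) by exact: measurableT_comp.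
apply/integrableP; split => //.
have /(integrable21ltyP _ _ mf) := fi; apply: le_lt_trans.
apply: ge0_le_integral => //; first exact: measurableT_comp.
  by apply: (measurable_fun_fubini_tonelli_G (abse \o f)) => //= z; exact: abse_ge0.
move=> y _; apply: le_abse_integral => //.
exact: measurableT_comp.
Qed.

Lemma Rintegral_fubini1 F : mP.-integrable setT (EFin \o F) ->
  m1.-integrable setT (EFin \o (fun x => \int[m2]_y F (x, y))) /\
  \int[m1]_x (\int[m2]_y F (x, y)) = \int[mP]_z F z.
Proof.
move=> iF; have [i1 e1] := integrable_fine (integrable_fubini_F iF).
split => //; rewrite /Rintegral; congr fine.
by rewrite -(integral12_prod_meas1 iF) -e1.
Qed.

Lemma Rintegral_fubini2 F : mP.-integrable setT (EFin \o F) ->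
  m2.-integrable setT (EFin \o (fun y => \int[m1]_x F (x, y))) /\
  \int[m2]_y (\int[m1]_x F (x, y)) = \int[mP]_z F z.
Proof.
move=> iF; have [i1 e1] := integrable_fine (integrable_fubini_G iF).
split => //; rewrite /Rintegral; congr fine.
by rewrite -(integral21_prod_meas1 iF) -e1.
Qed.

Definition tensor a b : T1 * T2 -> R := fun z => a z.1 * b z.2.

Lemma measurable_tensor a b : measurable_fun setT a -> measurable_fun setT b ->
  measurable_fun setT (tensor a b).
Proof.
by move=> ma mb; apply: measurable_funM; apply: measurableT_comp.
Qed.

Lemma integrable_tensor a b : m1.-integrable setT (EFin \o a) ->
  m2.-integrable setT (EFin \o b) -> mP.-integrable setT (EFin \o tensor a b).
Proof.
move=> ia ib; have /measurable_EFinP ma := measurable_int _ ia.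
have /measurable_EFinP mb := measurable_int _ ib.
apply/integrable12ltyP.
  by apply/measurable_EFinP; exact: measurable_tensor.
have /integrableP[mEa Ea] := ia; have /integrableP[mEb Eb] := ib.
have mnb : measurable_fun setT (fun y => `|(EFin \o b) y|%E).
  exact: measurableT_comp.
have mna : measurable_fun setT (fun x => `|(EFin \o a) x|%E).
  exact: measurableT_comp.
have tE x : (\int[m2]_y `|(EFin \o tensor a b) (x, y)| =
    `|(EFin \o a) x| * \int[m2]_y `|(EFin \o b) y|)%E.
  rewrite -ge0_integralZl//; apply: eq_integral => y _.
  by rewrite /= /tensor normrM EFinM.
under eq_integral do rewrite tE.
rewrite ge0_integralZr//; last exact: integral_ge0.
by rewrite lte_mul_pinfty ?integral_ge0 ?ge0_fin_numE ?integral_ge0.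
Qed.

Lemma Rintegral_tensor a b : m1.-integrable setT (EFin \o a) ->
  m2.-integrable setT (EFin \o b) ->
  \int[mP]_z tensor a b z = \int[m1]_x a x * \int[m2]_y b y.
Proof.
move=> ia ib; have [_ <-] := Rintegral_fubini1 (integrable_tensor ia ib).
rewrite -RintegralZr//; apply: eq_Rintegral => x _.
by rewrite -RintegralZl.
Qed.

Lemma Lfun2_tensor a b : a \in Lfun m1 2%:E -> b \in Lfun m2 2%:E ->
  tensor a b \in Lfun mP 2%:E.
Proof.
move=> /Lfun2P[ma ia] /Lfun2P[mb ib]; apply/Lfun2P; split.
  exact: measurable_tensor.
apply: (eq_integrable measurableT _ _ _ (integrable_tensor ia ib)).
by move=> z _; rewrite /= /tensor exprMn.
Qed.

Lemma inner_tensor a b a' b' : a \in Lfun m1 2%:E -> b \in Lfun m2 2%:E ->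
  a' \in Lfun m1 2%:E -> b' \in Lfun m2 2%:E ->
  inner mP (tensor a b) (tensor a' b') = inner m1 a a' * inner m2 b b'.
Proof.
move=> aL bL aL' bL'; rewrite /inner -Rintegral_tensor; last 2 first.
- exact: Lfun2_integrableM.
- exact: Lfun2_integrableM.
by apply: eq_Rintegral => z _; rewrite /tensor mulrACA.
Qed.

End product_integral.

(** * Transfer between measures that agree on measurable sets *)

Section equal_measures.
Context d (T : measurableType d) (R : realType).
Context (m m' : {measure set T -> \bar R}).
Hypothesis mm' : forall A, measurable A -> m A = m' A.

Lemma eq_measure_Rintegral (f : T -> R) : \int[m]_x f x = \int[m']_x f x.
Proof. by congr fine; apply: eq_measure_integral => A mA _; exact: mm'. Qed.

Lemma eq_measure_integrable (f : T -> \bar R) :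
  m.-integrable setT f -> m'.-integrable setT f.
Proof.
move=> /integrableP[mf foo]; apply/integrableP; split=> //.
rewrite (@eq_measure_integral _ _ _ _ m)// => A mA _; exact/esym/mm'.
Qed.

Lemma eq_measure_Lfun2 (f : T -> R) :
  f \in Lfun m 2%:E -> f \in Lfun m' 2%:E.
Proof.
by move=> /Lfun2P[mf fi]; apply/Lfun2P; split=> //; exact: eq_measure_integrable.
Qed.

End equal_measures.

(** * Generator, heat flow, kernel and entropy of a product *)

Lemma energy_ge0 (R : realType) d (T : topMeasurableType d) (X : MMD R T)
  (f : T -> R) : (0 <= energy X f)%E.
Proof.
rewrite /energy; case: asboolP => // fD; rewrite lee_fin.
exact: (df_ge0 (mmd_dirichlet X)).
Qed.

(** The generator turns the cross term [2 c E(a, f)] into an integral linear in [f]. Outside the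
    domain both sides are [+oo], because [f] is a combination of [a] and [a * c + f]; the lemma
    therefore applies to every section of a function. *)
Lemma energyD_generator (R : realType) d (T : topMeasurableType d) (X : MMD R T)
    (a h f : T -> R) (c k : R) : generator X a h ->
    (mmd_dom X f -> k = \int[mmd_meas X]_x (h x * c * f x)) ->
  energy X (fun x => a x * c + f x) =
  (energy X f + (c ^+ 2 * mmd_form X a a - 2 * k)%:E)%E.
Proof.
have Xd := mmd_dirichlet X.
move=> [aD hL aE] kE; rewrite /energy.
have acE : (fun x => a x * c + f x) = cst c \* a \+ f.
  by apply/funext => x /=; rewrite mulrC.
case: (asboolP (mmd_dom X f)) => [fD|fND]; last first.
  rewrite asboolF ?addye// acE => afD; apply: fND.
  have := df_lin Xd (-c) aD afD.
  rewrite (_ : _ \+ _ = f)//; apply/funext => x /=; ring.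
have afD := df_lin Xd c aD fD.
rewrite acE asboolT// df_bilin// (df_sym Xd aD afD) (df_sym Xd fD afD).
rewrite !df_bilin// (df_sym Xd fD aD) kE// aE// -EFinD; congr EFin.
have -> : \int[mmd_meas X]_x (h x * c * f x) = c * \int[mmd_meas X]_x (h x * f x).
  rewrite -RintegralZl//; last first.
    by apply: Lfun2_integrableM => //; exact: (df_L2 Xd).
  by apply: eq_Rintegral => x _; ring.
by rewrite aE//; ring.
Qed.

Section product.
Context (R : realType) d1 d2 (T1 : topMeasurableType d1)
  (T2 : topMeasurableType d2) (X1 : MMD R T1) (X2 : MMD R T2)
  (Y : MMD R (T1 * T2)%type).
Hypothesis prodY : is_product X1 X2 Y.
Local Notation m1 := (mmd_meas X1).
Local Notation m2 := (mmd_meas X2).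
Local Notation mY := (mmd_meas Y).
Local Notation mP := (m1 \x m2)%E.

Let mYP A : measurable A -> mY A = mP A.
Proof. by case: prodY => _ + _ _; exact. Qed.

Let mPY A : measurable A -> mP A = mY A.
Proof. by move=> mA; rewrite mYP. Qed.

Let tensor_Y a b : a \in Lfun m1 2%:E -> b \in Lfun m2 2%:E ->
  tensor a b \in Lfun mY 2%:E.
Proof. by move=> aL bL; apply: (eq_measure_Lfun2 mPY); exact: Lfun2_tensor. Qed.

Let sqnorm_tensor a b : a \in Lfun m1 2%:E -> b \in Lfun m2 2%:E ->
  inner mY (tensor a b) (tensor a b) = inner m1 a a * inner m2 b b.
Proof.
by move=> aL bL; rewrite -inner_tensor// /inner; exact: eq_measure_Rintegral.
Qed.

(** The square expansion is carried out on each section, where the tensor is a multiple of [a] or of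
    [b], and then integrated over the other factor; Fubini collects the linear terms into one inner
    product on [Y]. *)
Lemma product_energyD a b h1 h2 g : generator X1 a h1 -> generator X2 b h2 ->
    mmd_dom Y g ->
  product_energy X1 X2 (tensor a b \+ g) = (mmd_form Y g g +
    (inner m2 b b * mmd_form X1 a a + inner m1 a a * mmd_form X2 b b -
     2 * inner mY (tensor h1 b \+ tensor a h2) g))%:E.
Proof.
move=> ag bg gD; have [_ _ domY formY] := prodY.
have [aD h1L aE] := ag; have [bD h2L bE] := bg.
have aL := df_L2 (mmd_dirichlet X1) aD; have bL := df_L2 (mmd_dirichlet X2) bD.
have gL := df_L2 (mmd_dirichlet Y) gD.
pose F1 z := tensor h1 b z * g z; pose F2 z := tensor a h2 z * g z.
have iF1 : mP.-integrable setT (EFin \o F1).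
  apply: (eq_measure_integrable mYP); apply: Lfun2_integrableM => //.
  exact: tensor_Y.
have iF2 : mP.-integrable setT (EFin \o F2).
  apply: (eq_measure_integrable mYP); apply: Lfun2_integrableM => //.
  exact: tensor_Y.
have [iG1 eG1] := Rintegral_fubini2 iF1.
have [iG2 eG2] := Rintegral_fubini1 iF2.
(* The changes in energy of the sections of [g] at height [y] and, for [k2], at abscissa [x]. *)
pose k1 y := b y ^+ 2 * mmd_form X1 a a - 2 * \int[m1]_x F1 (x, y).
pose k2 x := a x ^+ 2 * mmd_form X2 b b - 2 * \int[m2]_y F2 (x, y).
have /Lfun2P[_ ia2] := aL; have /Lfun2P[_ ib2] := bL.
have ik1 : m2.-integrable setT (EFin \o k1).
  apply: integrable_EFinB; last exact: integrable_EFinZl.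
  apply: (eq_integrable measurableT); last exact: (integrable_EFinZl (mmd_form X1 a a) ib2).
  by move=> y _; rewrite /= mulrC.
have ik2 : m1.-integrable setT (EFin \o k2).
  apply: integrable_EFinB; last exact: integrable_EFinZl.
  apply: (eq_integrable measurableT); last exact: (integrable_EFinZl (mmd_form X2 b b) ia2).
  by move=> y _; rewrite /= mulrC.
have e1 y : energy X1 (fun x => (tensor a b \+ g) (x, y)) =
    (energy X1 (fun x => g (x, y)) + (k1 y)%:E)%E.
  exact: (@energyD_generator _ _ _ X1 a h1 (fun x => g (x, y)) (b y) _ ag).
have e2 x : energy X2 (fun y => (tensor a b \+ g) (x, y)) =
    (energy X2 (fun y => g (x, y)) + (k2 x)%:E)%E.
  rewrite -(@energyD_generator _ _ _ X2 b h2 (fun y => g (x, y)) (a x)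
    (\int[m2]_y F2 (x, y)) bg) => [|_].
    by congr (energy _ _); apply/funext => y; rewrite /= /tensor /= [b y * _]mulrC.
  by apply: eq_Rintegral => y _; rewrite /F2 /tensor/= [h2 y * _]mulrC.
have Ik1 : \int[m2]_y k1 y =
    inner m2 b b * mmd_form X1 a a - 2 * inner mY (tensor h1 b) g.
  rewrite /k1 RintegralB//; last 2 first.
  - apply: (eq_integrable measurableT); last exact: (integrable_EFinZl (mmd_form X1 a a) ib2).
    by move=> y _; rewrite /= mulrC.
  - exact: integrable_EFinZl.
  rewrite RintegralZr// RintegralZl// eG1 /inner (eq_measure_Rintegral mYP).
  by congr (_ * _ - _); apply: eq_Rintegral => y _; rewrite expr2.
have Ik2 : \int[m1]_x k2 x =
    inner m1 a a * mmd_form X2 b b - 2 * inner mY (tensor a h2) g.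
  rewrite /k2 RintegralB//; last 2 first.
  - apply: (eq_integrable measurableT); last exact: (integrable_EFinZl (mmd_form X2 b b) ia2).
    by move=> y _; rewrite /= mulrC.
  - exact: integrable_EFinZl.
  rewrite RintegralZr// RintegralZl// eG2 /inner (eq_measure_Rintegral mYP).
  by congr (_ * _ - _); apply: eq_Rintegral => y _; rewrite expr2.
rewrite [in RHS]EFinD formY// /product_energy.
under eq_integral do rewrite e1.
under [X in (_ + X)%E]eq_integral do rewrite e2.
rewrite !integralD_nonmeasurable//; last 4 first.
- by move=> x; exact: energy_ge0.
- by move=> x; rewrite -e2; exact: energy_ge0.
- by move=> x; exact: energy_ge0.
- by move=> x; rewrite -e1; exact: energy_ge0.
rewrite addeACA; congr (_ + _)%E.
rewrite -(fineK (integrable_fin_num measurableT ik1)).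
rewrite -(fineK (integrable_fin_num measurableT ik2)) -EFinD; congr EFin.
rewrite -/(Rintegral _ _ _) -/(Rintegral _ _ _) Ik1 Ik2.
have := inner_lin 1 (tensor_Y h1L bL) (tensor_Y aL h2L) gL.
rewrite (_ : (fun x => _) = tensor h1 b \+ tensor a h2); last first.
  by apply/funext => x; rewrite mul1r.
by move=> ->; ring.
Qed.

(** The tensor lies in the domain because its product energy is finite. Comparing the expansion of
    the energy at [g] with bilinearity isolates the form between the tensor and [g]. *)
Lemma generator_tensor a b h1 h2 : generator X1 a h1 -> generator X2 b h2 ->
  generator Y (tensor a b) (tensor h1 b \+ tensor a h2).
Proof.
move=> ag bg; have [_ _ domY formY] := prodY.
have Yd := mmd_dirichlet Y.
have [aD h1L _] := ag; have [bD h2L _] := bg.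
have aL := df_L2 (mmd_dirichlet X1) aD; have bL := df_L2 (mmd_dirichlet X2) bD.
have abD g : mmd_dom Y g -> mmd_dom Y (tensor a b \+ g).
  move=> gD; apply/domY; split; last by rewrite (product_energyD ag bg gD) ltry.
  have := Lfun2_lin 1 (tensor_Y aL bL) (df_L2 Yd gD).
  by rewrite (_ : (fun x => _) = tensor a b \+ g)//; apply/funext => x; rewrite mul1r.
have D0 := df_zero Yd.
have ab0 : tensor a b \+ cst 0 = tensor a b by apply/funext => x /=; rewrite addr0.
have abDD : mmd_dom Y (tensor a b) by rewrite -ab0; exact: abD.
have E0 : mmd_form Y (cst 0) (cst 0) = 0.
  have := df_bilin Yd (-1) D0 D0 D0.
  rewrite (_ : cst (-1) \* cst 0 \+ cst 0 = cst 0); first by move=> ->; ring.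
  by apply/funext => x /=; rewrite mulr0 addr0.
have formD g : mmd_dom Y g -> mmd_form Y (tensor a b \+ g) (tensor a b \+ g) =
    mmd_form Y g g + (inner m2 b b * mmd_form X1 a a +
      inner m1 a a * mmd_form X2 b b -
      2 * inner mY (tensor h1 b \+ tensor a h2) g).
  by move=> gD; apply: EFin_inj; rewrite formY ?(product_energyD ag bg gD)//; exact: abD.
split=> // [|g gD].
  have := Lfun2_lin 1 (tensor_Y h1L bL) (tensor_Y aL h2L).
  rewrite (_ : (fun x => _) = tensor h1 b \+ tensor a h2)//.
  by apply/funext => x; rewrite mul1r.
(* The case [g = 0] evaluates the form on the tensor itself, which cancels from the general case. *)
have := formD _ gD; have := formD _ D0.
rewrite ab0 E0 add0r innerC inner0l mulr0 subr0 => <-.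
have -> : tensor a b \+ g = cst 1 \* tensor a b \+ g.
  by apply/funext => x /=; rewrite mul1r.
have abgD := df_lin Yd 1 abDD gD.
rewrite df_bilin// (df_sym Yd abDD abgD) (df_sym Yd gD abgD) !df_bilin//.
rewrite (df_sym Yd gD abDD) /inner => H; lra.
Qed.


(** The squared norm of a tensor is a product. The condition [A * B = 0] allows either factor to
    vanish in the limit while the other merely converges. *)
Let cvg_tensor0 (I : Type) (F : set_system I) (FF : ProperFilter F)
    (u : I -> T1 -> R) (v : I -> T2 -> R) (A B : R) :
    (\forall i \near F, u i \in Lfun m1 2%:E) ->
    (\forall i \near F, v i \in Lfun m2 2%:E) ->
    inner m1 (u i) (u i) @[i --> F] --> A ->
    inner m2 (v i) (v i) @[i --> F] --> B -> A * B = 0 ->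
  (\forall i \near F, tensor (u i) (v i) \in Lfun mY 2%:E) /\
  inner mY (tensor (u i) (v i)) (tensor (u i) (v i)) @[i --> F] --> (0 : R).
Proof.
move=> uL vL uA vB AB0; split.
  by near=> i; apply: tensor_Y; near: i.
rewrite -AB0; apply: cvg_trans (cvgM uA vB); apply: near_eq_cvg; near=> i.
by rewrite sqnorm_tensor//; near: i.
Unshelve. all: by end_near. Qed.

Let cvg_sum0 (I : Type) (F : set_system I) (FF : ProperFilter F)
    (u v : I -> T1 * T2 -> R) :
    (\forall i \near F, u i \in Lfun mY 2%:E) /\
      inner mY (u i) (u i) @[i --> F] --> (0 : R) ->
    (\forall i \near F, v i \in Lfun mY 2%:E) /\
      inner mY (v i) (v i) @[i --> F] --> (0 : R) ->
  (\forall i \near F, u i \+ v i \in Lfun mY 2%:E) /\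
  inner mY (u i \+ v i) (u i \+ v i) @[i --> F] --> (0 : R).
Proof.
move=> [uL u0] [vL v0]; split; last exact: cvg_inner_sqrD0.
near=> i; rewrite (_ : u i \+ v i = fun z => 1 * u i z + v i z); last first.
  by apply/funext => z; rewrite mul1r.
by apply: Lfun2_lin; near: i.
Unshelve. all: by end_near. Qed.

Lemma heat_solution_tensor f1 f2 u v : f1 \in Lfun m1 2%:E ->
  f2 \in Lfun m2 2%:E -> heat_solution X1 f1 u -> heat_solution X2 f2 v ->
  heat_solution Y (tensor f1 f2) (fun t => tensor (u t) (v t)).
Proof.
move=> f1L f2L us vs; split=> [t t0|].
  have [h1 ug1 lim1] := us.1 _ t0; have [h2 vg2 lim2] := vs.1 _ t0.
  exists (tensor h1 (v t) \+ tensor (u t) h2); first exact: generator_tensor.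
  have [_ h1L _] := ug1; have [_ h2L _] := vg2.
  have utL := heat_solution_Lfun us t0; have vtL := heat_solution_Lfun vs t0.
  pose q1 s x := (u (t + s) x - u t x) / s - h1 x.
  pose q2 s y := (v (t + s) y - v t y) / s - h2 y.
  have q1L : \forall s \near (0 : R)^', q1 s \in Lfun m1 2%:E.
    exact: heat_solution_quotient us t0 h1L.
  have q2L : \forall s \near (0 : R)^', q2 s \in Lfun m2 2%:E.
    exact: heat_solution_quotient vs t0 h2L.
  have q1lim : inner m1 (q1 s) (q1 s) @[s --> (0 : R)^'] --> (0 : R) by [].
  have q2lim : inner m2 (q2 s) (q2 s) @[s --> (0 : R)^'] --> (0 : R) by [].
  have dvL := heat_solution_shift vs t0.
  have dvlim := heat_solution_continuous vs t0.
  have FF := Proper_dnbhs_numFieldType (0 : R).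
  have constL (S : Type) (A : set S) (x : S) : A x ->
    \forall s \near (0 : R)^', A x by move=> Ax; near=> s.
  have clim (r : R) : r @[s --> (0 : R)^'] --> r by exact: cvg_cst.
  (* Product rule: with [dv = v (t + s) - v t], the error of the quotient is the sum of the tensors
     [q1 v], [u q2], [q1 dv] and [h1 dv], with [u] and [v] taken at [t]. *)
  have c1 := cvg_tensor0 FF q1L (constL _ _ _ vtL) q1lim (clim _) (mul0r _).
  have c2 := cvg_tensor0 FF (constL _ _ _ utL) q2L (clim _) q2lim (mulr0 _).
  have c3 := cvg_tensor0 FF q1L dvL q1lim dvlim (mulr0 _).
  have c4 := cvg_tensor0 FF (constL _ _ _ h1L) dvL (clim _) dvlim (mulr0 _).
  case: (cvg_sum0 FF (cvg_sum0 FF c1 c2) (cvg_sum0 FF c3 c4)) => _.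
  apply: cvg_trans; apply: near_eq_cvg; near=> s.
  have s_neq0 : s != 0 by near: s; exact: nbhs_dnbhs_neq.
  by apply: eq_Rintegral => z _; rewrite /tensor /q1 /q2 /=; field.
have du : \forall t \near (0 : R)^'+, u t \- f1 \in Lfun m1 2%:E.
  by near=> t; apply: Lfun2B => //; exact: heat_solution_Lfun us _.
have dv : \forall t \near (0 : R)^'+, v t \- f2 \in Lfun m2 2%:E.
  by near=> t; apply: Lfun2B => //; exact: heat_solution_Lfun vs _.
have FF := at_right_proper_filter (0 : R).
have constL (S : Type) (A : set S) (x : S) : A x ->
  \forall s \near (0 : R)^'+, A x by move=> Ax; near=> s.
have clim (r : R) : r @[s --> (0 : R)^'+] --> r by exact: cvg_cst.
(* Here [u v - f1 f2 = (u - f1) f2 + f1 (v - f2) + (u - f1) (v - f2)]. *)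
have c1 := cvg_tensor0 FF du (constL _ _ _ f2L) us.2 (clim _) (mul0r _).
have c2 := cvg_tensor0 FF (constL _ _ _ f1L) dv (clim _) vs.2 (mulr0 _).
have c3 := cvg_tensor0 FF du dv us.2 vs.2 (mulr0 _).
case: (cvg_sum0 FF (cvg_sum0 FF c1 c2) c3) => _.
apply: cvg_trans; apply: near_eq_cvg; near=> t.
by apply: eq_Rintegral => z _; rewrite /tensor /=; ring.
Unshelve. all: by end_near. Qed.

(** Rectangles of finite open sets form a base whose indicators are tensors, so the tensor of the
    two heat flows starts from them. *)
Lemma kernel_product t z w : 0 < t ->
  mmd_kernel Y t z w = mmd_kernel X1 t z.1 w.1 * mmd_kernel X2 t z.2 w.2.
Proof.
pose base := [set A | exists B1 B2,
  [/\ finite_open X1 B1, finite_open X2 B2 & A = B1 `*` B2]].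
apply: (@heat_kernel_unique _ _ _ Y base (fun t z w =>
  mmd_kernel X1 t z.1 w.1 * mmd_kernel X2 t z.2 w.2)).
- move=> z0 V [[V1 V2] /= [V1z V2z] V12].
  have [B1 [fB1 B1z BV1]] := finite_open_nbhs X1 V1z.
  have [B2 [fB2 B2z BV2]] := finite_open_nbhs X2 V2z.
  exists (B1 `*` B2); split=> //; first by exists B1, B2.
    have [oB1 _] := fB1; have [oB2 _] := fB2.
    rewrite openE => x [B1x B2x]; exists (B1, B2) => //=.
    by split; apply: open_nbhs_nbhs.
  by move=> x [/BV1 xV1 /BV2 xV2]; apply: V12.
- move=> {}t t0.
  have c1 : continuous (fun x : (T1 * T2) * (T1 * T2) =>
      mmd_kernel X1 t x.1.1 x.2.1).
    move=> x; apply: (@continuous_comp _ _ _ (fun x => (x.1.1, x.2.1))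
      (fun x : T1 * T1 => mmd_kernel X1 t x.1 x.2)).
      by apply: (continuous_prod_map (f := fst) (g := fst)) => y; exact: cvg_fst.
    exact: kernel_continuous2.
  have c2 : continuous (fun x : (T1 * T2) * (T1 * T2) =>
      mmd_kernel X2 t x.1.2 x.2.2).
    move=> x; apply: (@continuous_comp _ _ _ (fun x => (x.1.2, x.2.2))
      (fun x : T2 * T2 => mmd_kernel X2 t x.1 x.2)).
      by apply: (continuous_prod_map (f := snd) (g := snd)) => y; exact: cvg_snd.
    exact: kernel_continuous2.
  by move=> x; apply: cvgM; [exact: c1|exact: c2].
- move=> {}t x t0; apply: (eq_measure_integrable mPY).
  by apply: integrable_tensor; exact: kernel_integrable.
move=> _ [B1 [B2 [fB1 fB2 ->]]].
have B1L := Lfun2_indic fB1; have B2L := Lfun2_indic fB2.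
have -> : \1_(B1 `*` B2) = tensor \1_B1 \1_B2 :> (T1 * T2 -> R).
  apply/funext => x; rewrite /tensor !indicE in_setX.
  by case: (_ \in _); case: (_ \in _); rewrite ?mulr1 ?mulr0.
split; first exact: tensor_Y.
exists (fun t => tensor (heat X1 t \1_B1) (heat X2 t \1_B2)).
  by apply: heat_solution_tensor => //; exact: heat_is_solution.
move=> {}t x t0; rewrite Rintegral_mkcond /tensor /heat.
have i1 := Lfun2_integrableM (kernel_Lfun2 X1 x.1 t0) B1L.
have i2 := Lfun2_integrableM (kernel_Lfun2 X2 x.2 t0) B2L.
rewrite -(Rintegral_tensor i1 i2) -(eq_measure_Rintegral mYP).
apply: eq_Rintegral => y _; rewrite patchE /tensor in_setX !indicE.
by case: (_ \in _); case: (_ \in _); rewrite ?mulr1 ?mulr0 ?mul0r.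
Qed.

(** The logarithm splits the integrand into two tensors, each with a factor of integral 1; the
    normalization is additive because it is linear in the dimension. *)
Lemma nash_product N1 N2 z t : 0 < t ->
  nash Y (N1 + N2) z t = nash X1 N1 z.1 t + nash X2 N2 z.2 t.
Proof.
move=> t0; rewrite /nash.
pose p1 := mmd_kernel X1 t z.1; pose p2 := mmd_kernel X2 t z.2.
have i1 : m1.-integrable setT (EFin \o p1) by exact: kernel_integrable.
have i2 : m2.-integrable setT (EFin \o p2) by exact: kernel_integrable.
have l1 : m1.-integrable setT (EFin \o (fun x => p1 x * ln (p1 x))).
  exact: (nash_finite (mmd_nash X1)).
have l2 : m2.-integrable setT (EFin \o (fun x => p2 x * ln (p2 x))).
  exact: (nash_finite (mmd_nash X2)).
have -> : \int[mY]_w (mmd_kernel Y t z w * ln (mmd_kernel Y t z w)) =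
    \int[mP]_w (tensor (fun x => p1 x * ln (p1 x)) p2 w +
                tensor p1 (fun y => p2 y * ln (p2 y)) w).
  rewrite -(eq_measure_Rintegral mYP); apply: eq_Rintegral => w _.
  rewrite kernel_product// lnM ?posrE ?(hk_gt0 (mmd_heat X1))//; last first.
    exact: (hk_gt0 (mmd_heat X2)).
  by rewrite /tensor /p1 /p2; ring.
rewrite RintegralD//; [|exact: integrable_tensor..].
rewrite !Rintegral_tensor// (hk_conservative (mmd_heat X1))//.
by rewrite (hk_conservative (mmd_heat X2))// /p1 /p2; ring.
Qed.

Lemma nash2_product N1 N2 z t s : 0 < N1 -> 0 < N2 -> 0 < t -> 0 < s ->
  nash2 Y (N1 + N2) z t s = nash2 X1 N1 z.1 t s + nash2 X2 N2 z.2 t s.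
Proof.
move=> N10 N20 t0 s0; rewrite /nash2 /heat.
pose p1 := mmd_kernel X1 s z.1; pose p2 := mmd_kernel X2 s z.2.
have i1 : m1.-integrable setT (EFin \o p1) by exact: kernel_integrable.
have i2 : m2.-integrable setT (EFin \o p2) by exact: kernel_integrable.
have l1 : m1.-integrable setT (EFin \o (fun x => p1 x * nash X1 N1 x t)).
  exact: (nash_integrable (mmd_nash X1)).
have l2 : m2.-integrable setT (EFin \o (fun x => p2 x * nash X2 N2 x t)).
  exact: (nash_integrable (mmd_nash X2)).
have -> : \int[mY]_w (mmd_kernel Y s z w * nash Y (N1 + N2) w t) =
    \int[mP]_w (tensor (fun x => p1 x * nash X1 N1 x t) p2 w +
                tensor p1 (fun y => p2 y * nash X2 N2 y t) w).
  rewrite -(eq_measure_Rintegral mYP); apply: eq_Rintegral => w _.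
  by rewrite kernel_product// nash_product// /tensor /p1 /p2; ring.
rewrite RintegralD//; [|exact: integrable_tensor..].
rewrite !Rintegral_tensor// (hk_conservative (mmd_heat X1))//.
by rewrite (hk_conservative (mmd_heat X2))// mulr1 mul1r.
Qed.

End product.

(** * Half-open boxes generate the Borel sets of [R^m] *)

Section boxes.
Context (R : realType) (m : nat).
Implicit Types (a b x : 'rV[R]_m).

Definition box a b : set 'rV[R]_m := [set x | forall i, a 0 i < x 0 i <= b 0 i].

Definition boxes : set (set 'rV[R]_m) := [set A | exists a b, A = box a b].

Lemma setI_closed_boxes : setI_closed boxes.
Proof.
move=> _ _ [a [b ->]] [a' [b' ->]].
exists (\row_i Num.max (a 0 i) (a' 0 i)), (\row_i Num.min (b 0 i) (b' 0 i)).
apply/seteqP; split=> x /=.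
  move=> [xab xab'] i; rewrite !mxE gt_max le_min.
  by have /andP[-> ->] := xab i; have /andP[-> ->] := xab' i.
move=> xab; split=> i; have := xab i; rewrite !mxE gt_max le_min;
  by move=> /andP[/andP[? ?] /andP[? ?]]; apply/andP.
Qed.

Lemma box_empty a b i : b 0 i < a 0 i -> box a b = set0.
Proof.
move=> ba; apply/seteqP; split=> // x /(_ i) /andP[ax xb].
by have := lt_le_trans (lt_trans ba ax) xb; rewrite ltxx.
Qed.

Lemma box_measurable a b : measurable (box a b).
Proof.
have half i (c : R) : measurable [set x : 'rV[R]_m | c < x 0 i].
  apply: sub_sigma_algebra.
  apply: (@open_comp _ _ (fun x : 'rV[R]_m => x 0 i) [set r | c < r]).
    by move=> x _; exact: coord_continuous.
  exact: open_gt.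
rewrite (_ : box a b = \bigcap_(i in [set: 'I_m])
    ([set x | a 0 i < x 0 i] `&` ~` [set x | b 0 i < x 0 i])); last first.
  apply/seteqP; split=> x /= xab i.
    by have /andP[? ?] := xab i; split=> //; apply/negP; rewrite -leNgt.
  have [? /negP] := xab i I; rewrite -leNgt => ?; exact/andP.
apply: fin_bigcap_measurable; first exact: finite_finset.
by move=> i _; exact: (measurableI _ _ (half i _) (measurableC (half i _))).
Qed.

(** Every point of [U] lies in a box with rational corners inside a sup-norm ball contained in
    [U]. *)
Lemma open_sub_boxes (U : set 'rV[R]_m) : open U -> <<s boxes >> U.
Proof.
move=> oU; pose rbox (q : 'rV[rat]_m * 'rV[rat]_m) :=
  box (map_mx ratr q.1) (map_mx ratr q.2).
have -> : U = \bigcup_(q in [set q | rbox q `<=` U]) rbox q.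
  apply/seteqP; split=> [x Ux|x [q] /= qU]; last exact: qU.
  have /nbhs_ballP[e /= e0 xeU] := open_nbhs_nbhs (conj oU Ux).
  have lower i : {q : rat | x 0 i - e < ratr q < x 0 i}.
    by apply: cid; apply: rat_in_itvoo; rewrite ltrBlDr ltrDl.
  have upper i : {q : rat | x 0 i < ratr q < x 0 i + e}.
    by apply: cid; apply: rat_in_itvoo; rewrite ltrDl.
  exists (\row_i sval (lower i), \row_i sval (upper i)) => /=.
    move=> y /= yb; apply: xeU; split => // i j; rewrite !ord1 {i}.
    have := yb j; rewrite !mxE; case: (lower j) => p /= /andP[p1 p2].
    case: (upper j) => q /= /andP[q1 q2] /andP[py yq].
    by rewrite /ball/= ltr_norml; apply/andP; split; lra.
  move=> i /=; rewrite !mxE; case: (lower i) => p /= /andP[_ ->].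
  by case: (upper i) => q /= /andP[/ltW-> _].
have -> : \bigcup_(q in [set q | rbox q `<=` U]) rbox q =
    \bigcup_n (if unpickle n is Some q then
                 if `[< rbox q `<=` U >] then rbox q else set0
               else set0).
  apply/seteqP; split=> [x [q /= qU xq]|x [n _]].
    by exists (pickle q) => //; rewrite pickleK asboolT.
  case: unpickle => [q|//]; case: asboolP => // qU xq.
  by exists q.
apply: sigma_algebra_bigcup => n; case: unpickle => [q|]; last first.
  exact: (sigma_algebra0 _).
case: ifP => _; last exact: (sigma_algebra0 _).
by apply: sub_sigma_algebra; exists (map_mx ratr q.1), (map_mx ratr q.2).
Qed.

Lemma measurable_boxes : @measurable _ 'rV[R]_m = <<s boxes >>.
Proof.
apply/seteqP; split=> A.
  by apply: smallest_sub; [exact: smallest_sigma_algebra|exact: open_sub_boxes].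
apply: smallest_sub; first exact: sigma_algebra_measurable.
by move=> _ [a [b ->]]; exact: box_measurable.
Qed.

End boxes.

(** * Dilations and translations of [R^m] *)

Section affine.
Context (R : realType) (m : nat) (l : R) (b : 'rV[R]_m).
Hypothesis l_gt0 : 0 < l.

Definition affine (x : 'rV[R]_m) : 'rV[R]_m := l *: x + b.

Lemma affine_continuous : continuous affine.
Proof.
move=> x; have xx : x @[x --> x] --> x by exact: cvg_id.
exact: (cvgD (cvgZl_tmp xx) (cvg_cst b)).
Qed.

Lemma affine_box a c :
  affine @^-1` (box a c) = box (l^-1 *: (a - b)) (l^-1 *: (c - b)).
Proof.
apply/seteqP; split=> x /= xac i; have /andP[] := xac i; rewrite /affine !mxE.
  move=> ax xc; rewrite -(ltr_pM2l l_gt0) -(ler_pM2l l_gt0) !mulVKf ?gt_eqF//.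
  by apply/andP; split; lra.
rewrite -(ltr_pM2l l_gt0) -(ler_pM2l l_gt0) !mulVKf ?gt_eqF// => ax xc.
by apply/andP; split; lra.
Qed.

Lemma affine_derivable (f : 'rV[R]_m -> R) x v : derivable f (affine x) v ->
  derivable (f \o affine) x v /\ 'D_v (f \o affine) x = l * 'D_v f (affine x).
Proof.
move=> df.
have lim : h^-1 *: ((f \o affine \o shift x) (h *: v) - (f \o affine) x)
    @[h --> (0 : R)^'] --> l * 'D_v f (affine x).
  have : l * ((l * h)^-1 *: ((f \o shift (affine x)) ((l * h) *: v) - f (affine x)))
      @[h --> (0 : R)^'] --> l * 'D_v f (affine x).
    by apply: cvgMl_tmp; exact: (cvg_comp _ _ (cvg_scale_dnbhs l_gt0) df).
  apply: cvg_trans; apply: near_eq_cvg; near=> h.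
  have h_neq0 : h != 0 by near: h; exact: nbhs_dnbhs_neq.
  have -> : (f \o affine \o shift x) (h *: v) = (f \o shift (affine x)) ((l * h) *: v).
    by rewrite /= /affine scalerDr scalerA addrA.
  rewrite /GRing.scale /=; field.
  by rewrite h_neq0 gt_eqF.
split; last exact: cvg_lim.
by apply/cvg_ex; exists (l * 'D_v f (affine x)).
Unshelve. all: by end_near. Qed.

End affine.

Lemma affineK (R : realType) (m : nat) (l : R) (b : 'rV[R]_m) : 0 < l ->
  cancel (affine l b) (affine l^-1 (- (l^-1 *: b))).
Proof.
move=> l0 x; rewrite /affine scalerDr scalerA mulVf ?gt_eqF// scale1r.
by rewrite addrK.
Qed.

Lemma affineVK (R : realType) (m : nat) (l : R) (b : 'rV[R]_m) : 0 < l ->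
  cancel (affine l^-1 (- (l^-1 *: b))) (affine l b).
Proof.
move=> l0 x; rewrite /affine scalerDr scalerN !scalerA mulfV ?gt_eqF//.
by rewrite !scale1r subrK.
Qed.

(** * Lebesgue measure and weak gradients under affine maps *)

Section euclidean_affine.
Context (R : realType) (m : nat) (E : MMD R 'rV[R]_m).
Hypothesis eE : is_euclidean E.
Local Notation mE := (mmd_meas E).

Let affine_measurable l b : measurable_fun setT (@affine R m l b).
Proof. exact: (continuous_measurable_map E E (@affine_continuous R m l b)). Qed.

(** When two corner coordinates are out of order the box is empty, although the product of the
    differences may be nonzero; hence the case distinction. *)
Let box_measure a c : mE (box a c) =
  (if [forall i, a 0 i <= c 0 i] then \prod_(i < m) (c 0 i - a 0 i) else 0)%:E.
Proof.
case: ifPn => [/forallP ac|]; first by case: eE => _ + _ _; exact.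
by rewrite negb_forall => /existsP[i]; rewrite -ltNge => /box_empty->; exact: measure0.
Qed.

(** The pushforward and the multiple of [mE] agree on boxes, which are stable under intersection,
    generate the sigma-algebra and exhaust the space with finite measure, so they coincide. *)
Lemma measure_affine l b A : 0 < l -> measurable A ->
  mE (affine l b @^-1` A) = ((l ^- m)%:E * mE A)%E.
Proof.
move=> l0 mA.
have l_ge0 : 0 <= l ^- m by rewrite invr_ge0 exprn_ge0// ltW.
pose k : {nonneg R} := NngNum l_ge0.
pose phi : {mfun 'rV[R]_m >-> 'rV[R]_m} :=
  HB.pack (affine l b) (isMeasurableFun.Build _ _ _ _ _ (affine_measurable l b)).
pose g (n : nat) : set 'rV[R]_m := box (const_mx (- n%:R)) (const_mx n%:R).
have Hm : forall B, boxes B -> pushforward mE phi B = mscale k mE B.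
  move=> _ [a [c ->]]; rewrite /pushforward /mscale /= affine_box// !box_measure.
  have leE i : ((l^-1 *: (a - b)) 0 i <= (l^-1 *: (c - b)) 0 i) = (a 0 i <= c 0 i).
    by rewrite !mxE ler_pM2l ?invr_gt0// lerD2r.
  under eq_forallb do rewrite leE.
  case: ifP => _; last by rewrite mule0.
  rewrite -EFinM; congr EFin.
  rewrite -[m in l ^- m]card_ord -exprVn -prodr_const -big_split/=.
  by apply: eq_bigr => i _; rewrite !mxE; ring.
have := @measure_unique _ _ _ (@boxes R m) g (measurable_boxes R m)
  (@setI_closed_boxes R m) _ _ (pushforward mE phi) (mscale k mE) Hm _ _ mA.
apply.
- by move=> n; exists (const_mx (- n%:R)), (const_mx n%:R).
- apply/seteqP; split=> // x _.
  pose n := (\max_(i < m) Num.bound `|x ord0 i|%R)%N.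
  exists n => // i; rewrite !mxE.
  have : `|x 0 i| < n%:R.
    apply: lt_le_trans (archi_boundP (normr_ge0 _)) _.
    by rewrite ler_nat (leq_bigmax i).
  by rewrite ltr_norml => /andP[-> /ltW].
- move=> n; have gn : boxes (g n) by exists (const_mx (- n%:R)), (const_mx n%:R).
  by have := Hm _ gn; rewrite /= => ->; rewrite /mscale /= box_measure -EFinM ltry.
Qed.

(** The chain rule is obtained by testing: a test function for [f \o affine l b] is carried to one
    for [f] by the inverse map, with a change of variables on either side. *)
Lemma weak_gradient_affine l b (f : 'rV[R]_m -> R) g : 0 < l ->
  f \in Lfun mE 2%:E ->
  weak_gradient mE f g ->
  weak_gradient mE (f \o affine l b) (fun i x => l * g i (affine l b x)).
Proof.
move=> l0 fL fg i; have [gL fgi] := fg i.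
have maff := affine_measurable l b.
have k0 : 0 < l ^- m by rewrite invr_gt0 exprn_gt0.
have maffE A (mA : measurable A) := measure_affine b l0 mA.
have gaL : g i \o affine l b \in Lfun mE 2%:E by exact: (Lfun2_image k0 maff maffE).
split; first exact: (Lfun2Z l gaL).
move=> phi [[cphi suppphi] dphi].
have l'0 : 0 < l^-1 by rewrite invr_gt0.
pose aff' := affine l^-1 (- (l^-1 *: b)).
(* The factor [l] offsets the [l^-1] produced by differentiating [aff']. *)
pose phi' x := l * phi (aff' x).
have dphi'E j x : derivable phi' x (delta_mx 0 j) /\
    'D_(delta_mx 0 j) phi' x = 'D_(delta_mx 0 j) phi (aff' x).
  have [dj _] := dphi j.
  have [dc Dc] := affine_derivable l'0 (dj (aff' x)).
  split; first exact: (@derivableZ _ _ _ _ l _ _ dc).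
  by apply: etrans (deriveZ l dc) _; rewrite Dc /GRing.scale/= mulVKf ?gt_eqF.
have caff' : continuous aff' by exact: affine_continuous.
have cphi' : continuous phi'.
  move=> x; have c : phi (aff' y) @[y --> x] --> phi (aff' x).
    exact: (@continuous_comp _ _ _ aff' phi x (caff' x) (cphi _)).
  exact: (cvgMl_tmp c).
have cD j : continuous (fun x => 'D_(delta_mx 0 j) phi' x).
  under eq_fun do rewrite (dphi'E _ _).2.
  move=> x; apply: (@continuous_comp _ _ _ aff' (fun x => 'D_(delta_mx 0 j) phi x)).
    exact: caff'.
  by have [_ c] := dphi j; exact: c.
have phi'C : C1c phi'.
  split; last by move=> j; split=> [x|]; [exact: (dphi'E j x).1|exact: cD].
  split=> //.
  (* The support of [phi'] lies in the image of the support of [phi]. *)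
  have cK : compact (affine l b @` closure [set x | phi x != 0]).
    by apply: continuous_compact => //; apply: continuous_subspaceT; exact: affine_continuous.
  apply: (subclosed_compact _ cK); first exact: closed_closure.
  have clK := compact_closed (@norm_hausdorff _ _) cK.
  rewrite [X in _ `<=` X](iffLR (closure_id _) clK).
  apply: closureS => x /=; rewrite /phi' mulf_eq0 gt_eqF//= => phix.
  exists (aff' x); last exact: affineVK.
  exact: subset_closure.
have mf := Lfun2_measurable fL; have mg := Lfun2_measurable gL.
have mF : measurable_fun setT (fun x => f x * 'D_(delta_mx 0 i) phi' x).
  by apply: measurable_funM => //; apply: (continuous_measurable E); exact: cD.
have mG : measurable_fun setT (fun x => g i x * phi' x).
  by apply: measurable_funM => //; exact: (continuous_measurable E).
transitivity (l ^- m * \int[mE]_x (f x * 'D_(delta_mx 0 i) phi' x)).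
  rewrite -(Rintegral_image k0 maff maffE mF); apply: eq_Rintegral => x _.
  by rewrite (dphi'E _ _).2 /aff' affineK.
rewrite (fgi _ phi'C) mulrN -(Rintegral_image k0 maff maffE mG); congr (- _).
apply: eq_Rintegral => x _; rewrite /phi' /aff' affineK//; ring.
Qed.

End euclidean_affine.

(** * Constancy of the Euclidean Nash entropy *)

Section euclidean_nash.
Context (R : realType) (m : nat) (E : MMD R 'rV[R]_m).
Hypothesis eE : is_euclidean E.

Let dom_affine l b f : 0 < l -> mmd_dom E f -> mmd_dom E (f \o affine l b).
Proof.
move=> l0; have [_ _ domE _] := eE.
move=> /domE[fL [g fg]]; apply/domE; split; last first.
  by exists (fun i x => l * g i (affine l b x)); exact: weak_gradient_affine.
have maff := continuous_measurable_map E E (@affine_continuous R m l b).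
have k0 : 0 < l ^- m by rewrite invr_gt0 exprn_gt0.
exact: (Lfun2_image k0 maff (fun A mA => measure_affine eE b l0 mA)).
Qed.

(** The measure scales by [k = l ^- m] and the form by [k * l ^+ 2], so the additive constant is
    [- m ln l + m / 2 * ln (l ^+ 2)]. It vanishes because the normalization dimension is [m]. *)
Lemma nash_affine l b x t : 0 < l -> 0 < t ->
  nash E m%:R x t = nash E m%:R (affine l b x) (l ^+ 2 * t).
Proof.
move=> l0 t0; have [_ _ domE formE] := eE.
have k0 : 0 < l ^- m by rewrite invr_gt0 exprn_gt0.
have l20 : 0 < l ^+ 2 by rewrite exprn_gt0.
have l'0 : 0 < l^-1 by rewrite invr_gt0.
have maff := continuous_measurable_map E E (@affine_continuous R m l b).
have maffE A (mA : measurable A) := measure_affine eE b l0 mA.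
have domP f : mmd_dom E f <-> mmd_dom E (f \o affine l b).
  split; first exact: dom_affine.
  move=> /(dom_affine (- (l^-1 *: b)) l'0).
  by rewrite (_ : _ \o _ = f)//; apply/funext => y /=; rewrite affineVK.
have formP f g : mmd_dom E f -> mmd_dom E g ->
    mmd_form E (f \o affine l b) (g \o affine l b) =
    l ^- m * l ^+ 2 * mmd_form E f g.
  move=> fD gD; have [fL [df fdf]] := (domE f).1 fD.
  have [gL [dg gdg]] := (domE g).1 gD.
  have fdfa := weak_gradient_affine eE b l0 fL fdf.
  have gdga := weak_gradient_affine eE b l0 gL gdg.
  rewrite (formE _ _ _ _ ((domP f).1 fD) ((domP g).1 gD) fdfa gdga).
  rewrite (formE _ _ _ _ fD gD fdf gdg) mulr_sumr; apply: eq_bigr => i _.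
  have [dfL _] := fdf i; have [dgL _] := gdg i.
  have := inner_image k0 maff maffE dfL dgL; rewrite /inner => h.
  rewrite mulrAC -h mulrC -RintegralZl//.
    by apply: eq_Rintegral => y _ /=; ring.
  exact: (Lfun2_integrableM (Lfun2_image k0 maff maffE dfL)
    (Lfun2_image k0 maff maffE dgL)).
rewrite (nash_transport k0 l20 (affineK b l0) (@affine_continuous R m l b)
  (@affine_continuous R m _ _) maffE domP formP _ _ t0).
rewrite lnV ?posrE ?exprn_gt0// !lnXn// -(mulr_natr (ln l) m) -mulr_natr.
by field.
Qed.

(* The dilation about [x] by the factor [t^-1/2] maps the pair (x, t) to (0, 1),
   so no explicit formula for the heat kernel is needed. *)
Lemma nash_euclidean x t : 0 < t -> nash E m%:R x t = nash E m%:R 0 1.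
Proof.
move=> t0; have l0 : 0 < (Num.sqrt t)^-1 by rewrite invr_gt0 sqrtr_gt0.
rewrite (nash_affine (- ((Num.sqrt t)^-1 *: x)) _ l0 t0).
rewrite /affine subrr exprVn sqr_sqrtr ?ltW// mulVf//.
exact: lt0r_neq0.
Qed.

Lemma nash2_euclidean x t s : 0 < t -> 0 < s ->
  nash2 E m%:R x t s = nash E m%:R 0 1.
Proof.
move=> t0 s0; rewrite -(heat_cst E (nash E m%:R 0 1) x s0) /nash2.
by congr (heat _ _ _ _); apply/funext => y; exact: nash_euclidean.
Qed.

End euclidean_nash.

(** * Concavity along inverse-time geodesics *)

Section concavity.
Context (R : realType).
Implicit Types (F G : R -> R -> R) (c : R -> R * R).

Lemma concave_alongP F c : concave_along F c <->
  forall p x y, 0 <= p <= 1 -> 0 <= x <= 1 -> 0 <= y <= 1 ->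
  p * F (c x).1 (c x).2 + (1 - p) * F (c y).1 (c y).2 <=
  F (c (p * x + (1 - p) * y)).1 (c (p * x + (1 - p) * y)).2.
Proof.
have convE (p : {i01 R}) (x y : R^o) :
  conv p (x : convex_lmodType R^o) y = p%:num * x + (1 - p%:num) * y :> R by [].
split=> [Fc p x y /andP[p0 p1] x01 y01|Fc p x y].
  have := Fc (Itv01 p0 p1) x y; rewrite !inE/= !in_itv/= => /(_ x01 y01).
  by rewrite [X in _ <= X]convE convE /=; lra.
rewrite !inE/= !in_itv/= => x01 y01.
have p01 : 0 <= p%:num <= 1 by apply/andP; split.
have := Fc p%:num x y p01 x01 y01.
by rewrite [X in _ -> _ <= X]convE convE /=; lra.
Qed.

Lemma convex_comb_itv01 (p x y : R) : 0 <= p <= 1 -> 0 <= x <= 1 ->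
  0 <= y <= 1 -> 0 <= p * x + (1 - p) * y <= 1.
Proof. by move=> *; apply/andP; split; nra. Qed.

(** Agreement on the curve suffices. This matters because the formulas for [nash2] hold only at
    positive times, which a geodesic guarantees. *)
Lemma concave_along_eq F G c :
  (forall th, 0 <= th <= 1 -> F (c th).1 (c th).2 = G (c th).1 (c th).2) ->
  concave_along F c -> concave_along G c.
Proof.
move=> FG /concave_alongP Fc; apply/concave_alongP => p x y p01 x01 y01.
by rewrite -!FG ?Fc//; exact: convex_comb_itv01.
Qed.

Lemma concave_alongD F G c : concave_along F c -> concave_along G c ->
  concave_along (fun t s => F t s + G t s) c.
Proof.
move=> /concave_alongP Fc /concave_alongP Gc; apply/concave_alongP => p x y p01 x01 y01.
by have := Fc p x y p01 x01 y01; have := Gc p x y p01 x01 y01; lra.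
Qed.

Lemma concave_along_cst (k : R) c : concave_along (fun _ _ => k) c.
Proof. by apply/concave_alongP => p x y _ _ _; lra. Qed.

Lemma geodesic_inv c p x y : inverse_time_geodesic c -> 0 <= p <= 1 ->
  0 <= x <= 1 -> 0 <= y <= 1 ->
  (c (p * x + (1 - p) * y)).1^-1 = p * (c x).1^-1 + (1 - p) * (c y).1^-1.
Proof.
move=> gc p01 x01 y01; have [_ _ _ ->] := gc _ (convex_comb_itv01 p01 x01 y01).
by have [_ _ _ ->] := gc _ x01; have [_ _ _ ->] := gc _ y01; ring.
Qed.

(** Along the geodesic, time is a weighted harmonic mean of two of its values, hence at most the
    arithmetic mean; [k <= 0] reverses the inequality. *)
Lemma concave_along_time (k : R) c : inverse_time_geodesic c -> k <= 0 ->
  concave_along (fun t _ => k * t) c.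
Proof.
move=> gc k0; apply/concave_alongP => p x y p01 x01 y01.
have z01 := convex_comb_itv01 p01 x01 y01.
have [tz _ _ _] := gc _ z01; have [tx _ _ _] := gc _ x01.
have [ty _ _ _] := gc _ y01; have zE := geodesic_inv gc p01 x01 y01.
move: tz zE; set z := (c (p * x + _)).1 => tz zE.
rewrite mulrCA [(1 - p) * _]mulrCA -mulrDr ler_wnM2l//.
have -> : z = (p * (c x).1^-1 + (1 - p) * (c y).1^-1)^-1 by rewrite -zE invrK.
rewrite -[X in X <= _]div1r ler_pdivrMr; last by rewrite -zE invr_gt0.
(* This identity exhibits the excess of the product of the two means over 1 as a square over a
   positive number. *)
have -> : (p * (c x).1 + (1 - p) * (c y).1) *
    (p * (c x).1^-1 + (1 - p) * (c y).1^-1) =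
    1 + p * (1 - p) * ((c x).1 - (c y).1) ^+ 2 / ((c x).1 * (c y).1).
  by field; rewrite !gt_eqF.
rewrite lerDl; have /andP[p0 p1] := p01.
have q0 : 0 <= 1 - p by rewrite subr_ge0.
apply: divr_ge0; last by rewrite ltW// mulr_gt0.
by apply: mulr_ge0; [exact: mulr_ge0|exact: sqr_ge0].
Qed.

(** Since [ln t = - ln t^-1] and [t^-1] is affine along the geodesic, concavity of [ln] makes [ln t]
    convex. *)
Lemma concave_along_log_time (k : R) c : inverse_time_geodesic c -> k <= 0 ->
  concave_along (fun t _ => k * ln t) c.
Proof.
move=> gc k0; apply/concave_alongP => p x y p01 x01 y01.
have z01 := convex_comb_itv01 p01 x01 y01.
have [tz _ _ _] := gc _ z01; have [tx _ _ _] := gc _ x01.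
have [ty _ _ _] := gc _ y01; have zE := geodesic_inv gc p01 x01 y01.
rewrite mulrCA [(1 - p) * _]mulrCA -mulrDr ler_wnM2l//.
have lnE (t : R) : 0 < t -> ln t = - ln t^-1 by move=> t0; rewrite lnV ?posrE// opprK.
rewrite (lnE _ tz) (lnE _ tx) (lnE _ ty) zE.
have /andP[p0 p1] := p01.
have := @concave_ln R (Itv01 p0 p1) (c x).1^-1 (c y).1^-1.
by rewrite !invr_gt0 !convRE/= /unstable.onem => /(_ tx ty); lra.
Qed.

Lemma concave_along_scale F l c :
  concave_along F (fun th => (l * (c th).1, l * (c th).2)) ->
  concave_along (fun t s => F (l * t) (l * s)) c.
Proof. by []. Qed.

Lemma geodesic_scale l c : 0 < l -> inverse_time_geodesic c ->
  inverse_time_geodesic (fun th => (l * (c th).1, l * (c th).2)).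
Proof.
move=> l0 gc th th01; have [t0 s0 ts tE] := gc _ th01.
split=> /=; rewrite ?mulr_gt0//; first by rewrite -!mulrDr ts.
by rewrite !invfM tE; ring.
Qed.

End concavity.

(** * Monotonicity in the curvature and dimension parameters *)

Section monotonicity.
Context (R : realType) d (T : topMeasurableType d) (X : MMD R T).
Implicit Types sigma N q tau S : R.

(** The two functions differ by a nonpositive multiple of [t], which is concave along every
    geodesic, so the scale is kept. *)
Lemma hsc_witness_le sigma sigma' N tau : sigma' <= sigma ->
  hsc_witness X sigma N tau -> hsc_witness X sigma' N tau.
Proof.
move=> le_sigma [tau0 Xtau]; split=> // x c gc ctau.
have k0 : (sigma' - sigma) / 2 <= 0 by lra.
have := concave_alongD (Xtau x c gc ctau) (concave_along_time gc k0).
by apply: concave_along_eq => th _ /=; field.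
Qed.

Lemma od_witness_le N q q' S : q' <= q ->
  od_witness X N q S -> od_witness X N q' S.
Proof.
move=> le_q [S0 XS]; split=> // x c gc cS.
have k0 : (q' - q) / 2 <= 0 by lra.
have := concave_alongD (XS x c gc cS) (concave_along_log_time gc k0).
by apply: concave_along_eq => th _ /=; field.
Qed.

End monotonicity.

(** * Scaling and renormalization of the measure *)

Section rescaling.
Context (R : realType) d (T : topMeasurableType d) (X Y : MMD R T) (a c : R).
Hypotheses (a_gt0 : 0 < a) (c_gt0 : 0 < c) (XY : is_rescaling a c X Y).
Implicit Types sigma N q tau S : R.

Let l_gt0 : 0 < a ^- 2. Proof. by rewrite invr_gt0 exprn_gt0. Qed.

(** Transport along the identity, with [Y] as source and [X] as target: its measure factor is [c]
    and its time factor [a ^- 2]. *)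
Lemma nash2_rescaling N x t s : 0 < N -> 0 < t -> 0 < s ->
  nash2 Y N x t s = nash2 X N x (a ^- 2 * t) (a ^- 2 * s) +
    (ln c + N / 2 * ln (a ^- 2)).
Proof.
case: XY => _ measE domE formE.
apply: (@nash2_transport _ _ _ _ _ Y X idfun idfun c (a ^- 2)) => //.
- by move=> y; exact: cvg_id.
- by move=> y; exact: cvg_id.
- by move=> f; rewrite domE.
Qed.

Lemma hsc_witness_rescaling sigma N tau : 0 < N ->
  hsc_witness X sigma N tau -> hsc_witness Y (a ^- 2 * sigma) N (a ^+ 2 * tau).
Proof.
move=> N0 [tau0 Xtau]; split; first by rewrite mulr_gt0// exprn_gt0.
move=> x ga gg gtau.
have lgtau th : 0 <= th <= 1 ->
    a ^- 2 * (ga th).1 < tau /\ a ^- 2 * (ga th).2 < tau.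
  by move=> /gtau[g1 g2]; rewrite !ltr_pdivrMl ?exprn_gt0.
have := concave_alongD
  (concave_along_scale (Xtau x _ (geodesic_scale l_gt0 gg) lgtau))
  (concave_along_cst (ln c + N / 2 * ln (a ^- 2)) ga).
apply: concave_along_eq => th /gg[t0 s0 _ _] /=; rewrite nash2_rescaling//; ring.
Qed.

(** Dilating time changes [ln t] by a constant only, so [q] is unchanged, whereas the linear term
    rescales [sigma]. *)
Lemma od_witness_rescaling N q S : 0 < N ->
  od_witness X N q S -> od_witness Y N q (a ^+ 2 * S).
Proof.
move=> N0 [S0 XS]; split; first by rewrite mulr_gt0// exprn_gt0.
move=> x ga gg gS.
have lgS th : 0 <= th <= 1 ->
    S <= a ^- 2 * (ga th).1 /\ a ^- 2 * (ga th).1 <= a ^- 2 * (ga th).2.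
  by move=> /gS[g1 g2]; rewrite ler_pdivlMl ?exprn_gt0// ler_pM2l.
have := concave_alongD
  (concave_along_scale (XS x _ (geodesic_scale l_gt0 gg) lgS))
  (concave_along_cst (ln c + N / 2 * ln (a ^- 2) - q / 2 * ln (a ^- 2)) ga).
apply: concave_along_eq => th /gg[t0 s0 _ _] /=; rewrite nash2_rescaling// lnM ?posrE//; ring.
Qed.

Lemma HSC_rescaling sigma N : 0 < N -> HSC X sigma N -> HSC Y (a ^- 2 * sigma) N.
Proof.
by move=> N0 [tau Xtau]; exists (a ^+ 2 * tau); exact: hsc_witness_rescaling.
Qed.

Lemma HSCod_rescaling sigma N q : 0 < N -> HSCod X sigma N q ->
  HSCod Y (a ^- 2 * sigma) N q.
Proof.
move=> N0 [Xsigma Xq]; split; first exact: HSC_rescaling.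
by move=> /Xq[S XS]; exists (a ^+ 2 * S); exact: od_witness_rescaling.
Qed.

End rescaling.

(** * Products of spaces with curvature bounds *)

Section product_curvature.
Context (R : realType) d1 d2 (T1 : topMeasurableType d1)
  (T2 : topMeasurableType d2) (X1 : MMD R T1) (X2 : MMD R T2)
  (Y : MMD R (T1 * T2)%type).
Hypothesis prodY : is_product X1 X2 Y.
Implicit Types sigma N q : R.

Lemma HSC_product sigma1 sigma2 N1 N2 : 0 < N1 -> 0 < N2 ->
  HSC X1 sigma1 N1 -> HSC X2 sigma2 N2 -> HSC Y (sigma1 + sigma2) (N1 + N2).
Proof.
move=> N10 N20 [tau1 [tau10 h1]] [tau2 [tau20 h2]].
exists (Num.min tau1 tau2); split; first by rewrite lt_min tau10.
move=> z c gc ctau.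
have ctau1 th : 0 <= th <= 1 -> (c th).1 < tau1 /\ (c th).2 < tau1.
  by move=> /ctau[]; rewrite !lt_min => /andP[? _] /andP[].
have ctau2 th : 0 <= th <= 1 -> (c th).1 < tau2 /\ (c th).2 < tau2.
  by move=> /ctau[]; rewrite !lt_min => /andP[_ ?] /andP[].
have := concave_alongD (h1 z.1 c gc ctau1) (h2 z.2 c gc ctau2).
apply: concave_along_eq => th /gc[t0 s0 _ _] /=.
by rewrite (nash2_product prodY)//; field.
Qed.

(** Stated for witnesses rather than for [HSCod], so that it also covers a factor with parameter 0,
    for which [HSCod] provides no scale. *)
Lemma od_witness_product N1 N2 q1 q2 S1 S2 : 0 < N1 -> 0 < N2 ->
  od_witness X1 N1 q1 S1 -> od_witness X2 N2 q2 S2 ->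
  od_witness Y (N1 + N2) (q1 + q2) (Num.max S1 S2).
Proof.
move=> N10 N20 [S10 h1] [S20 h2]; split; first by rewrite lt_max S10.
move=> z c gc cS.
have cS1 th : 0 <= th <= 1 -> S1 <= (c th).1 /\ (c th).1 <= (c th).2.
  by move=> /cS[]; rewrite ge_max => /andP[].
have cS2 th : 0 <= th <= 1 -> S2 <= (c th).1 /\ (c th).1 <= (c th).2.
  by move=> /cS[]; rewrite ge_max => /andP[].
have := concave_alongD (h1 z.1 c gc cS1) (h2 z.2 c gc cS2).
apply: concave_along_eq => th /gc[t0 s0 _ _] /=.
by rewrite (nash2_product prodY)//; field.
Qed.

End product_curvature.

(** * The Euclidean factor *)

Section euclidean_factor.
Context (R : realType) (m : nat) (E : MMD R 'rV[R]_m).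
Hypothesis eE : is_euclidean E.

Lemma hsc_witness_euclidean tau : 0 < tau -> hsc_witness E 0 m%:R tau.
Proof.
move=> tau0; split=> // x c gc _.
apply: concave_along_eq (concave_along_cst (nash E m%:R 0 1) c).
by move=> th /gc[t0 s0 _ _] /=; rewrite (nash2_euclidean eE)//; ring.
Qed.

(** A constant entropy satisfies the clause with [q = 0] at every scale, which lets the Euclidean
    factor enter [od_witness_product]. *)
Lemma od_witness_euclidean S : 0 < S -> od_witness E m%:R 0 S.
Proof.
move=> S0; split=> // x c gc _.
apply: concave_along_eq (concave_along_cst (nash E m%:R 0 1) c).
by move=> th /gc[t0 s0 _ _] /=; rewrite (nash2_euclidean eE)//; ring.
Qed.

End euclidean_factor.

Theorem proposition3p4 (R : realType) :
  (forall (d : measure_display) (T : topMeasurableType d) (X : MMD R T)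
      (sigma sigma' N q q' : R),
    0 < N -> 0 <= q <= N -> sigma' <= sigma -> 0 <= q' <= q ->
    HSCod X sigma N q ->
    [/\ HSCod X sigma' N q',
        forall tau : R, hsc_witness X sigma N tau -> hsc_witness X sigma' N tau &
        0 < q' -> forall S : R, od_witness X N q S -> od_witness X N q' S]) /\
  (forall (d : measure_display) (T : topMeasurableType d) (X Y : MMD R T)
      (a c sigma N : R),
    0 < a -> 0 < c -> 0 < N -> is_rescaling a c X Y ->
    (forall q : R, 0 <= q <= N ->
       HSCod X sigma N q -> HSCod Y (a ^- 2 * sigma) N q) /\
    (HSC X sigma N -> HSC Y (a ^- 2 * sigma) N)) /\
  (forall (d1 d2 : measure_display)
      (T1 : topMeasurableType d1) (T2 : topMeasurableType d2)
      (X1 : MMD R T1) (X2 : MMD R T2) (Y : MMD R (T1 * T2)%type)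
      (sigma1 sigma2 N1 N2 : R),
    0 < N1 -> 0 < N2 -> is_product X1 X2 Y ->
    (HSC X1 sigma1 N1 -> HSC X2 sigma2 N2 ->
       HSC Y (sigma1 + sigma2) (N1 + N2)) /\
    (forall q1 q2 : R, 0 < q1 <= N1 -> 0 < q2 <= N2 ->
       HSCod X1 sigma1 N1 q1 -> HSCod X2 sigma2 N2 q2 ->
       HSCod Y (sigma1 + sigma2) (N1 + N2) (q1 + q2))) /\
  (forall (d : measure_display) (T : topMeasurableType d) (m : nat)
      (X : MMD R T) (E : MMD R 'rV[R]_m) (Y : MMD R (T * 'rV[R]_m)%type)
      (sigma N q : R),
    (1 <= m)%N -> 0 < N -> 0 <= q <= N ->
    is_euclidean E -> is_product X E Y ->
    HSCod X sigma N q -> HSCod Y sigma (N + m%:R) q).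
Proof.
split; [|split; [|split]].
- move=> d T X sigma sigma' N q q' N0 _ le_sigma /andP[_ le_q] [[tau Xtau] Xq].
  split.
  + split; first by exists tau; exact: hsc_witness_le Xtau.
    (* A positive [q'] forces [q] to be positive, so the second clause for [q] is available. *)
    move=> q'0; have [S XS] := Xq (lt_le_trans q'0 le_q).
    by exists S; exact: od_witness_le XS.
  + by move=> tau'; exact: hsc_witness_le.
  + by move=> _ S; exact: od_witness_le.
- move=> d T X Y a c sigma N a0 c0 N0 XY; split.
    by move=> q _; exact: (HSCod_rescaling a0 c0 XY).
  exact: (HSC_rescaling a0 c0 XY).
- move=> d1 d2 T1 T2 X1 X2 Y sigma1 sigma2 N1 N2 N10 N20 XY; split.
    exact: HSC_product.
  move=> q1 q2 /andP[q10 _] /andP[q20 _] [X1h X1q] [X2h X2q].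
  split; first exact: (HSC_product XY).
  move=> _; have [S1 h1] := X1q q10; have [S2 h2] := X2q q20.
  by exists (Num.max S1 S2); exact: (od_witness_product XY).
- move=> d T m X E Y sigma N q m1 N0 _ eE XY [Xh Xq].
  have m0 : 0 < m%:R :> R by rewrite ltr0n.
  split.
    rewrite -[sigma]addr0; apply: (HSC_product XY) => //.
    by exists 1; exact: hsc_witness_euclidean.
  (* The 1 is an arbitrary positive scale for the Euclidean factor, which contributes 0 to [q]. *)
  move=> /Xq[S XS]; exists (Num.max S 1); rewrite -[q]addr0.
  by apply: (od_witness_product XY) => //; exact: od_witness_euclidean.
Qed.
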